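(* Let $I$ be a strongly stable ideal of $S=\mathbb{K}[x_1,\dots,x_l]$, let $\bar S=\mathbb{K}[x_1,\dots,x_{l-1}]$ and $\bar I=\bar S\cap I$. Assume that $S/I$ has the weak Lefschetz property. Then $$\beta_{i,i+j}(S/I)=\beta_{i,i+j}(\bar S/\bar I)+\binom{l-1}{i-1}\,c_j(S/I).$$
   Context: $\mathbb{K}$ is a field of characteristic $0$ and $S$ has the standard grading. A monomial ideal $I$ of $S$ is strongly stable if for every monomial (power-product) $t\in I$ and all $1\le i<j\le l$ with $x_j\mid t$, one has $x_i\cdot t/x_j\in I$. A graded ring $R=\bigoplus_{i\ge0}R_i$ over $\mathbb{K}$ with $\dim_{\mathbb{K}}R_i<\infty$ has the weak Lefschetz property if there exists $\ell\in R_1$ such that for every $i\ge0$ the multiplication map $\times\ell\colon R_i\to R_{i+1}$ has full rank (is injective or surjective). $\operatorname{HF}(S/I,j)=\dim_{\mathbb{K}}(S/I)_j$ is the Hilbert function, with $\operatorname{HF}(S/I,-1)=0$, and for all $j\ge0$ $$c_j(S/I)=\max\{\operatorname{HF}(S/I,j-1)-\operatorname{HF}(S/I,j),\,0\}.$$ $\beta_{i,k}(S/I)=\dim_{\mathbb{K}}\operatorname{Tor}_i^S(S/I,\mathbb{K})_k$ denotes the graded Betti numbers of $S/I$ over $S$, and $\beta_{i,k}(\bar S/\bar I)$ those of $\bar S/\bar I$ over $\bar S$.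
   Formalization: The formula is proved with c_{j+1}(S/I) in place of c_j(S/I), since the printed version fails, e.g. for l = 1, I = (x_1), i = 1, j = 0, where it would read 1 = 0. *)

(* Defs.v *)
From HB Require Import structures.
From mathcomp Require Import all_boot all_order all_algebra.
From mathcomp Require Import boolp classical_sets.
From mathcomp Require Import mpoly.

Set Implicit Arguments.
Unset Strict Implicit.
Unset Printing Implicit Defensive.

Import GRing.Theory.
Local Open Scope ring_scope.

(* Ideals are given by their (Prop-valued) membership predicates, and a quotient
   of vector spaces is handled through representatives: U / W below stands for
   U / (U `&` W), for subspaces U, W of V. *)

Definition has_qdim (K : fieldType) (V : lmodType K) (U W : set V) (d : nat) :
    Prop :=
  exists X : 'I_d -> V,
    [/\ forall i, U (X i),
        forall c : 'I_d -> K, W (\sum_i c i *: X i) -> forall i, c i = 0 &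
        forall v, U v -> exists c : 'I_d -> K, W (v - \sum_i c i *: X i)].

(* dim_K (U / W), with junk value 0 in the infinite-dimensional case. *)
Definition qdim (K : fieldType) (V : lmodType K) (U W : set V) : nat :=
  xget 0%N (has_qdim U W).

Section MonomialIdeals.
Variables (K : fieldType) (l : nat).
Implicit Types I : set {mpoly K[l]}.

(* The unit ideal is allowed (take 0%MM in A). *)
Definition monomial_ideal I : Prop :=
  exists A : set 'X_{1..l}, forall p : {mpoly K[l]},
    I p <-> exists s : seq ('X_{1..l} * {mpoly K[l]}),
              (forall t, t \in s -> A t.1) /\
              p = \sum_(t <- s) t.2 * 'X_[t.1].

Definition strongly_stable I : Prop :=
  monomial_ideal I /\
  forall (t : 'X_{1..l}) (i j : 'I_l),
    I 'X_[t] -> (i < j)%N -> (0 < t j)%N -> I 'X_[(t - U_(j)) + U_(i)].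

End MonomialIdeals.

Section GradedQuotient.
Variables (K : fieldType) (l : nat) (I : set {mpoly K[l]}).

Definition weak_lefschetz : Prop :=
  exists2 ell : {mpoly K[l]}, ell \is 1.-homog &
  forall i : nat,
    (forall p : {mpoly K[l]}, p \is i.-homog -> I (ell * p) -> I p) \/
    (forall q : {mpoly K[l]}, q \is i.+1.-homog ->
       exists2 p : {mpoly K[l]}, p \is i.-homog & I (q - ell * p)).

Definition hilbert_fun (j : nat) : nat :=
  qdim [set p : {mpoly K[l]} | p \is j.-homog] I.

(* The subtraction of nat is truncated, which accounts for the maximum with 0;
   the value of the Hilbert function at -1 is 0. *)
Definition hilbert_drop (j : nat) : nat :=
  ((if j is j'.+1 then hilbert_fun j' else 0) - hilbert_fun j)%N.

End GradedQuotient.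

(* v is an element of degree k in the graded free module
   \bigoplus_m S(- a m), whose m-th basis vector has degree a m. *)
Definition row_homog (K : fieldType) (l r : nat) (a : 'I_r -> nat) (k : nat)
    (v : 'rV[{mpoly K[l]}]_r) : Prop :=
  forall m (t : 'X_{1..l}), t \in msupp (v 0 m) -> (a m + mdeg t = k)%N.

(* A graded resolution of S/I by free S-modules of finite rank (not necessarily
   minimal nor of finite length)
     ... --> F_2 --> F_1 --> F_0 --> S/I --> 0,
   where F_i has rank res_rk i, with a basis of degrees res_shift i. Elements of
   F_i are row vectors and maps act on the right. The augmentation F_0 --> S/I is
   given by representatives in S of the images of the basis of F_0. *)
Record graded_free_resolution (K : fieldType) (l : nat) (I : set {mpoly K[l]}) :=
  GradedFreeResolution {
    res_rk : nat -> nat;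
    res_shift : forall i, 'I_(res_rk i) -> nat;
    res_diff : forall i, 'M[{mpoly K[l]}]_(res_rk i.+1, res_rk i);
    res_aug : 'M[{mpoly K[l]}]_(res_rk 0, 1);
    _ : forall i k (v : 'rV[{mpoly K[l]}]_(res_rk i.+1)),
          row_homog (@res_shift i.+1) k v ->
          row_homog (@res_shift i) k (v *m res_diff i);
    _ : forall k (v : 'rV[{mpoly K[l]}]_(res_rk 0)),
          row_homog (@res_shift 0) k v -> (v *m res_aug) 0 0 \is k.-homog;
    _ : forall p : {mpoly K[l]}, exists v : 'rV[{mpoly K[l]}]_(res_rk 0),
          I (p - (v *m res_aug) 0 0);
    _ : forall v : 'rV[{mpoly K[l]}]_(res_rk 0),
          I ((v *m res_aug) 0 0) <-> exists w, v = w *m res_diff 0;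
    _ : forall i (v : 'rV[{mpoly K[l]}]_(res_rk i.+1)),
          v *m res_diff i = 0 <-> exists w, v = w *m res_diff i.+1
  }.

Section Betti.
Variables (K : fieldType) (l : nat) (I : set {mpoly K[l]}).
Variable F : graded_free_resolution I.

(* The complex F \otimes_S K, where K = S/(x_1, ..., x_l): its i-th term is
   K^(res_rk i) and its maps are the constant terms of those of F. *)
Definition tor_diff (i : nat) : 'M[K]_(res_rk F i.+1, res_rk F i) :=
  map_mx (mcoeff 0%MM) (res_diff F i).

Definition tor_degree (i k : nat) : set 'rV[K]_(res_rk F i) :=
  [set v | forall m, v 0 m != 0 -> res_shift m = k].

Definition tor_cycle (i : nat) : set 'rV[K]_(res_rk F i) :=
  match i with
  | 0 => setT
  | i'.+1 => [set v | v *m tor_diff i' = 0]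
  end.

Definition tor_boundary (i : nat) : set 'rV[K]_(res_rk F i) :=
  [set v | exists w, v = w *m tor_diff i].

(* The dimension of Tor_i^S(S/I, K)_k, computed with the resolution F. *)
Definition graded_betti (i k : nat) : nat :=
  qdim [set v | tor_degree k v /\ tor_cycle v] (@tor_boundary i).

End Betti.

(* mwiden embeds K[x_1, ..., x_n] in K[x_1, ..., x_n, x_(n+1)]. *)
Definition contraction (K : fieldType) (n : nat) (I : set {mpoly K[n.+1]}) :
    set {mpoly K[n]} :=
  [set p | I (mwiden p)].

(* Main.v *)
Require Import Defs.
From HB Require Import structures.
From mathcomp Require Import all_boot all_order all_algebra.
From mathcomp Require Import boolp classical_sets.
From mathcomp Require Import mpoly.

Set Implicit Arguments.
Unset Strict Implicit.
Unset Printing Implicit Defensive.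

Import GRing.Theory.
Local Open Scope ring_scope.

(** Write S for the polynomial ring in x_1, ..., x_(n+1), S' for that in the
    first n variables, I' for the contraction of I, and x for x_(n+1). The proof
    goes through Koszul homology.

    Tor_i (S / I, K) is the Koszul homology H_i (x_1, ..., x_(n+1); S / I)
    ([betti_koszul]). This balancing of Tor is obtained by dimension shifting
    along the given resolution ([koszul_iso], [koszul_shift], [koszul_tor_shift]),
    since Koszul complexes of free modules are acyclic ([row_koszul_exact]).

    Adding the last variable gives a long exact sequence that relates
    H_i (x_1, ..., x_(n+1); S / I) to the Koszul homology on n variables of the
    cokernel S' / I' and of the kernel V of the multiplication by x on S / I. The
    cokernel lifts to S / I as an S'-module, since S' is a subring of S, so the
    sequence splits ([koszul_last]):
      H_i (S / I) = H_i (S' / I') + H_(i-1) (V).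
    Strong stability implies that all variables annihilate V ([stable_socle]), so
    H_(i-1) (V) is a sum of 'C(n, i - 1) copies of V ([kos_qdim]).

    It remains to compute the dimension of V in degree j. If a linear form is
    injective on S / I in degree j, then so is x, because V is in the socle. If it
    is surjective from degree j to degree j + 1, eliminating its last variable,
    which preserves I ([stable_subst]), shows that the monomials of degree j + 1
    prime to x are in I, so that x is surjective as well ([surj_last]). In both
    cases the dimension of V in degree j is the drop of the Hilbert function from
    j to j + 1 ([kernel_qdim]).

    Quotients U / W are handled through representatives, and isomorphisms between
    them as linear correspondences ([has_qdim_corr_iff]). *)

(** * Dimensions of quotients *)

Section QuotientDimension.
Variable K : fieldType.

(** Linear subspaces, as Prop-valued predicates. *)
Definition subspace (V : lmodType K) (W : set V) : Prop :=
  W 0 /\ forall c u v, W u -> W v -> W (c *: u + v).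

Section Subspace.
Variables (V : lmodType K) (W : set V).
Hypothesis sW : subspace W.

Lemma subspace0 : W 0. Proof. by case: sW. Qed.

Lemma subspaceD u v : W u -> W v -> W (u + v).
Proof. by case: sW => _ h wu wv; rewrite -[u]scale1r; apply: h. Qed.

Lemma subspaceZ c u : W u -> W (c *: u).
Proof. by case: sW => w0 h wu; rewrite -[_ *: _]addr0; apply: h. Qed.

Lemma subspaceN u : W u -> W (- u).
Proof. by move=> wu; rewrite -scaleN1r; apply: subspaceZ. Qed.

Lemma subspaceB u v : W u -> W v -> W (u - v).
Proof. by move=> wu wv; apply: subspaceD => //; apply: subspaceN. Qed.

Lemma subspace_sum (J : Type) (r : seq J) (P : pred J) (f : J -> V) :
  (forall j, P j -> W (f j)) -> W (\sum_(j <- r | P j) f j).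
Proof. by move=> h; apply: (big_ind W subspace0 subspaceD h). Qed.

Lemma subspace_comb d (c : 'I_d -> K) (X : 'I_d -> V) :
  (forall i, W (X i)) -> W (\sum_i c i *: X i).
Proof. by move=> h; apply: subspace_sum => i _; apply: subspaceZ. Qed.

Lemma subspace_congr u v : W (u - v) -> W u <-> W v.
Proof.
move=> h; split=> w; last by rewrite -(subrK v u); apply: subspaceD.
by rewrite -(subKr u v); apply: subspaceB.
Qed.

End Subspace.

Lemma subspaceI (V : lmodType K) (U W : set V) :
  subspace U -> subspace W -> subspace [set v | U v /\ W v].
Proof.
move=> [u0 hu] [w0 hw]; split=> // c u v /= [uu wu] [uv wv].
by split; [apply: hu | apply: hw].
Qed.

Lemma subspace_preim (V V' : lmodType K) (f : {linear V -> V'}) (W : set V') :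
  subspace W -> subspace [set v | W (f v)].
Proof.
move=> [w0 hw]; split=> [|c u v wu wv] /=; first by rewrite linear0.
by rewrite linearP; apply: hw.
Qed.

(** A family independent modulo W has at most as many members as one spanning
    modulo W. *)
Lemma indep_le_span (V : lmodType K) (W : set V) d e
    (X : 'I_d -> V) (Y : 'I_e -> V) :
    subspace W ->
    (forall c : 'I_d -> K, W (\sum_i c i *: X i) -> forall i, c i = 0) ->
    (forall i, exists c : 'I_e -> K, W (X i - \sum_j c j *: Y j)) ->
  (d <= e)%N.
Proof.
move=> sW indep span; rewrite leqNgt; apply/negP => lt_ed.
have [A hA] := choice span.
pose M := \matrix_(i < d, j < e) A i j.
have : kermx M != 0.
  by rewrite kermx_eq0 /row_free neq_ltn (leq_ltn_trans (rank_leq_col _) lt_ed).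
case/rowV0Pn => u /sub_kermxP uM0 /negP; apply; apply/eqP/rowP => i; rewrite mxE.
apply: indep i; set s := (X in W X).
have -> : s = \sum_i u 0 i *: (X i - \sum_j A i j *: Y j).
  under eq_bigr do rewrite scalerBr.
  rewrite sumrB; set z := (X in _ - X); suff -> : z = 0 by rewrite subr0.
  rewrite /z; under eq_bigr do rewrite scaler_sumr.
  rewrite exchange_big /= big1 // => j _.
  under eq_bigr do rewrite scalerA.
  rewrite -scaler_suml.
  have -> : \sum_(i < d) u 0 i * A i j = (u *m M) 0 j.
    by rewrite mxE; apply: eq_bigr => i _; rewrite mxE.
  by rewrite uM0 mxE scale0r.
by apply: subspace_comb.
Qed.

Lemma has_qdim_uniq (V : lmodType K) (U W : set V) d e :
  subspace W -> has_qdim U W d -> has_qdim U W e -> d = e.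
Proof.
move=> sW [X [uX iX sX]] [Y [uY iY sY]]; apply/eqP; rewrite eqn_leq.
apply/andP; split.
- by apply: (indep_le_span sW iX) => i; apply: sY.
- by apply: (indep_le_span sW iY) => i; apply: sX.
Qed.

Lemma qdimE (V : lmodType K) (U W : set V) d :
  subspace W -> has_qdim U W d -> qdim U W = d.
Proof.
move=> sW h; rewrite /qdim.
have hx : has_qdim U W (xget 0%N (has_qdim U W)) by apply: (xgetPex 0%N); exists d.
exact: has_qdim_uniq hx h.
Qed.

(** A subquotient of a finite-dimensional space is finite-dimensional: a family
    in U that is independent modulo W and of maximal length is a basis. *)
Lemma has_qdim_ex (V : lmodType K) (U W : set V) e (Y : 'I_e -> V) :
    subspace U -> subspace W ->
    (forall u, U u -> exists c : 'I_e -> K, W (u - \sum_j c j *: Y j)) ->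
  exists d, has_qdim U W d.
Proof.
move=> sU sW span.
pose P d := exists X : 'I_d -> V, (forall i, U (X i)) /\
  (forall c : 'I_d -> K, W (\sum_i c i *: X i) -> forall i, c i = 0).
have leP d : P d -> (d <= e)%N.
  move=> [X [uX iX]]; apply: (indep_le_span sW iX) => i; exact: span.
have P0 : P 0%N by exists (fun _ => 0); split=> [i|c _ []//]; apply: subspace0 sU.
have [d [Pd maxd]] : exists d, P d /\ forall d', P d' -> (d' <= d)%N.
  have ex : exists n, `[< P n >] by exists 0%N; apply/asboolP.
  have bd n : `[< P n >] -> (n <= e)%N by move/asboolP/leP.
  case: (ex_maxnP ex bd) => m /asboolP Pm hm; exists m; split=> // d' hd'.
  by apply: hm; apply/asboolP.
exists d; case: Pd => X [uX iX]; exists X; split=> // v Uv.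
apply: contrapT => /forallNP nspan.
suff /maxd : P d.+1 by rewrite ltnn.
exists (fun i => if unlift ord_max i is Some j then X j else v); split.
  by move=> i; case: unliftP.
move=> c; rewrite big_ord_recr /= unlift_none.
under eq_bigr => i _.
  have -> : widen_ord (leqnSn d) i = lift ord_max i.
    by apply: val_inj; rewrite /= /bump leqNgt ltn_ord.
  rewrite liftK; over.
move=> Wc.
have cmax : c ord_max = 0.
  apply/eqP/negP => /negP nz; apply: (nspan (fun i => - (c ord_max)^-1 * c (lift ord_max i))).
  have := subspaceZ sW (c ord_max)^-1 Wc.
  rewrite scalerDr scalerA mulVf // scale1r addrC scaler_sumr.
  rewrite -sumrN; congr (W (_ + _)); apply: eq_bigr => i _.
  by rewrite scalerA mulNr scaleNr opprK.
move: Wc; rewrite cmax scale0r addr0 => /(iX (fun i => c (lift ord_max i))) h i.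
by case: (unliftP ord_max i) => [j ->|-> //]; apply: h.
Qed.

(** Dimensions of quotients are transported by linear correspondences: R need
    not be a map, nor be defined on all of V or V'. *)
Lemma has_qdim_corr (V V' : lmodType K) (U W : set V) (U' W' : set V')
    (R : V -> V' -> Prop) d :
    subspace U -> subspace U' ->
    R 0 0 ->
    (forall c u v u' v', R u u' -> R v v' -> R (c *: u + v) (c *: u' + v')) ->
    (forall u, U u -> exists2 u', U' u' & R u u') ->
    (forall u', U' u' -> exists2 u, U u & R u u') ->
    (forall u u', U u -> U' u' -> R u u' -> W u <-> W' u') ->
  has_qdim U W d -> has_qdim U' W' d.
Proof.
move=> sU sU' R0 RP RU RU' RW [X [uX iX sX]].
have [X' hX'] := choice (fun i => let: ex_intro2 u a b := RU _ (uX i) in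
                                ex_intro (fun u => U' u /\ R (X i) u) u (conj a b)).
have RS c : R (\sum_i c i *: X i) (\sum_i c i *: X' i).
  apply: (big_ind2 R) => // [u u' v v' ru rv|i _].
    by rewrite -[u]scale1r -[u']scale1r; apply: RP.
  rewrite -[_ *: X i]addr0 -[_ *: X' i]addr0; apply: RP => //.
  by case: (hX' i).
have uX' i : U' (X' i) by case: (hX' i).
exists X'; split=> // [c Wc|v' Uv'].
  by apply: iX; apply/(RW _ _ _ _ (RS c)) => //; apply: subspace_comb.
have [v Uv Rv] := RU' _ Uv'; have [c Wc] := sX _ Uv; exists c.
apply/(RW (v - \sum_i c i *: X i)) => //.
- by apply: subspaceB => //; apply: subspace_comb.
- by apply: subspaceB => //; apply: subspace_comb.
- by rewrite addrC -scaleN1r [_ - \sum_i c i *: X' i]addrC -scaleN1r; apply: RP.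
Qed.

Lemma has_qdim_corr_iff (V V' : lmodType K) (U W : set V) (U' W' : set V')
    (R : V -> V' -> Prop) d :
    subspace U -> subspace U' ->
    R 0 0 ->
    (forall c u v u' v', R u u' -> R v v' -> R (c *: u + v) (c *: u' + v')) ->
    (forall u, U u -> exists2 u', U' u' & R u u') ->
    (forall u', U' u' -> exists2 u, U u & R u u') ->
    (forall u u', U u -> U' u' -> R u u' -> W u <-> W' u') ->
  has_qdim U W d <-> has_qdim U' W' d.
Proof.
move=> sU sU' R0 RP RU RU' RW; split.
  exact: (has_qdim_corr sU sU' R0 RP RU RU' RW).
apply: (has_qdim_corr (R := fun u' u => R u u') sU' sU R0) => //.
- by move=> c u v u' v'; apply: RP.
- by move=> u u' Uu Uu' /RW h; rewrite h.
Qed.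

Lemma eq_has_qdim (V : lmodType K) (U W U' W' : set V) d :
    (forall v, U v <-> U' v) -> (forall v, W v <-> W' v) ->
  has_qdim U W d <-> has_qdim U' W' d.
Proof. by move=> /predeqP -> /predeqP ->. Qed.

Lemma has_qdim0 (V : lmodType K) (U W : set V) :
  (forall v, U v -> W v) -> has_qdim U W 0.
Proof.
move=> UW; exists (fun _ => 0); split=> [[]//|c _ []//|v Uv].
by exists (fun _ => 0); rewrite big_ord0 subr0; apply: UW.
Qed.

(** Additivity of dimension along a linear map f inducing a surjection
    U / W --> U' / W'. *)
Lemma has_qdim_ses (V V' : lmodType K) (f : {linear V -> V'})
    (U W : set V) (U' W' : set V') a b :
    subspace U -> subspace W -> subspace U' -> subspace W' ->
    (forall u, U u -> U' (f u)) ->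
    (forall u, W u -> W' (f u)) ->
    (forall u', U' u' -> exists2 u, U u & W' (u' - f u)) ->
    has_qdim [set u | U u /\ W' (f u)] W a -> has_qdim U' W' b ->
  has_qdim U W (a + b).
Proof.
move=> sU sW sU' sW' fU fW fs [X [uX iX sX]] [Y [uY iY sY]].
have [Z hZ] := choice (fun i => let: ex_intro2 u p q := fs _ (uY i) in
                   ex_intro (fun u => U u /\ W' (Y i - f u)) u (conj p q)).
pose T i := match split i with inl j => X j | inr j => Z j end.
have Tl j : T (lshift b j) = X j by rewrite /T (unsplitK (inl j)).
have Tr j : T (rshift a j) = Z j by rewrite /T (unsplitK (inr j)).
have sumT c : \sum_i c i *: T i =
    \sum_i c (lshift b i) *: X i + \sum_i c (rshift a i) *: Z i.
  by rewrite big_split_ord; congr (_ + _); apply: eq_bigr => i _; rewrite (Tl, Tr).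
have WX (c : 'I_a -> K) : W' (f (\sum_i c i *: X i)).
  rewrite linear_sum; apply: subspace_sum => // i _; rewrite linearZ.
  by apply: subspaceZ => //; case: (uX i).
have WZ (c : 'I_b -> K) : W' (\sum_i c i *: Y i - f (\sum_i c i *: Z i)).
  rewrite linear_sum -sumrB; apply: subspace_sum => // i _.
  by rewrite linearZ -scalerBr; apply: subspaceZ => //; case: (hZ i).
exists T; split=> [i|c|v Uv].
- by rewrite /T; case: (split i) => j; [case: (uX j) | case: (hZ j)].
- rewrite sumT => Wc.
  have c2 j : c (rshift a j) = 0.
    apply: (iY (fun j => c (rshift a j))); apply/(subspace_congr sW' (WZ _)).
    have := fW _ Wc; rewrite linearD => h.
    set s1 := f (\sum_i c (lshift b i) *: X i) in h.
    set s2 := f (\sum_i c (rshift a i) *: Z i) in h *.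
    have -> : s2 = (s1 + s2) - s1 by rewrite addrC addKr.
    by apply: (subspaceB sW' h); apply: WX.
  move: Wc; rewrite [X in _ + X]big1 => [|j _]; last by rewrite c2 scale0r.
  rewrite addr0 => /iX c1 i; rewrite -[i]splitK; case: (split i) => j /=.
    exact: c1.
  exact: c2.
- have [c2 hc2] := sY _ (fU _ Uv).
  have [] := sX (v - \sum_i c2 i *: Z i).
    split; first by apply: subspaceB => //; apply: subspace_comb => // i; case: (hZ i).
    rewrite linearB /= -(subrK (\sum_i c2 i *: Y i) (f v)) -addrA.
    exact: subspaceD.
  move=> c1 hc1; exists (fun i => match split i with inl j => c1 j | inr j => c2 j end).
  rewrite sumT.
  under eq_bigr do rewrite (unsplitK (inl _)).
  under [X in _ - (_ + X)]eq_bigr do rewrite (unsplitK (inr _)).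
  by rewrite opprD addrA addrAC.
Qed.

Lemma has_qdim_prod (V V' : lmodType K) (U W : set V) (U' W' : set V') a b :
    has_qdim U W a -> has_qdim U' W' b ->
    subspace U -> subspace W -> subspace U' -> subspace W' ->
  has_qdim [set u : V * V' | U u.1 /\ U' u.2] [set u | W u.1 /\ W' u.2] (a + b).
Proof.
move=> hU hU' sU sW sU' sW'.
have sp (A : set V) (B : set V') : subspace A -> subspace B ->
    subspace [set u : V * V' | A u.1 /\ B u.2].
  by move=> sA sB; apply: subspaceI;
    [apply: (subspace_preim fst) | apply: (subspace_preim snd)].
apply: (has_qdim_ses (f := snd) (U' := U') (W' := W')) => //; try exact: sp.
- by move=> u [].
- by move=> u [].
- move=> u' Uu'; exists (0, u'); first by split=> //=; apply: subspace0.
  by rewrite /= subrr; apply: subspace0.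
apply: (has_qdim_corr (R := fun v u => u.1 = v /\ W' u.2)) hU => //.
- apply: subspaceI; first exact: sp.
  exact: (subspace_preim snd).
- by split=> //; apply: subspace0.
- move=> c u v u' v' [<- w1] [<- w2]; split=> //=.
  by apply: subspaceD => //; apply: subspaceZ.
- move=> u Uu; exists (u, 0) => //=; do ?split=> //=; apply: subspace0 => //.
- by move=> u [[Uu Uu'] Wu']; exists u.1.
- by move=> u u' Uu _ [<- w] /=; split=> [|[]].
Qed.

End QuotientDimension.

(** * Koszul complexes *)

Section KoszulModule.
Variable K : fieldType.

(** The module underlying the Koszul complex of n endomorphisms of M, that is
    2 ^ n copies of M: an element of kos M n.+1 is a pair (a, b), which stands
    for a + b e_n in terms of the exterior generator e_n. *)
Fixpoint kos (M : lmodType K) (n : nat) : lmodType K :=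
  if n is n'.+1 then (kos M n' * kos M n')%type else M.

(** The coefficientwise action of a map on Koszul modules. *)
Fixpoint kmap (M N : lmodType K) (f : M -> N) n : kos M n -> kos N n :=
  match n with
  | 0 => f
  | n'.+1 => fun u => (kmap f u.1, kmap f u.2)
  end.

(** All coefficients satisfy P. *)
Fixpoint kall (M : lmodType K) (P : set M) n : set (kos M n) :=
  match n with
  | 0 => P
  | n'.+1 => [set u | kall P u.1 /\ kall P u.2]
  end.

(** u has homological degree p; zero has every degree. *)
Fixpoint hdeg (M : lmodType K) n (p : nat) : set (kos M n) :=
  match n with
  | 0 => [set u | p = 0%N \/ u = 0]
  | n'.+1 => [set u | hdeg p u.1 /\ (if p is p'.+1 then hdeg p' u.2 else u.2 = 0)]
  end.

(** The inclusion of M as the part of homological degree 0, and the projection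
    onto it. *)
Fixpoint kinj (M : lmodType K) n : M -> kos M n :=
  match n with
  | 0 => id
  | n'.+1 => fun m => (kinj n' m, 0)
  end.

Fixpoint kproj (M : lmodType K) n : kos M n -> M :=
  match n with
  | 0 => id
  | n'.+1 => fun u => kproj u.1
  end.

(** The Koszul differential: d (a + b e_n) = d a + x_n b - (d b) e_n. *)
Fixpoint kdiff (M : lmodType K) (x : nat -> M -> M) n : kos M n -> kos M n :=
  match n with
  | 0 => fun=> 0
  | n'.+1 => fun u => (kdiff x u.1 + kmap (x n') u.2, - kdiff x u.2)
  end.

Section Linear.
Variables M N : lmodType K.

Lemma kmap_is_linear (f : {linear M -> N}) n : linear (@kmap M N f n).
Proof.
elim: n => [|n IH] c u v /=; first exact: linearP.
by congr (_, _); rewrite IH.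
Qed.

HB.instance Definition _ (f : {linear M -> N}) n :=
  GRing.isLinear.Build K (kos M n) (kos N n) _ (@kmap M N f n)
    (kmap_is_linear f (n:=n)).

End Linear.

Section Maps.
Variables M : lmodType K.

Lemma kdiff_is_linear (x : nat -> {linear M -> M}) n : linear (@kdiff M x n).
Proof.
elim: n => [|n IH] c u v /=; first by rewrite scaler0 addr0.
congr (_, _) => /=; last by rewrite IH opprD scalerN.
by rewrite IH linearP scalerDr addrACA.
Qed.

HB.instance Definition _ (x : nat -> {linear M -> M}) n :=
  GRing.isLinear.Build K (kos M n) (kos M n) _ (@kdiff M x n)
    (kdiff_is_linear x (n:=n)).

Lemma kproj_is_linear n : linear (@kproj M n).
Proof. by elim: n => [|n IH] c u v //=; rewrite IH. Qed.

HB.instance Definition _ n :=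
  GRing.isLinear.Build K (kos M n) M _ (@kproj M n) (kproj_is_linear (n:=n)).

Lemma kinjK n : cancel (@kinj M n) (@kproj M n).
Proof. by elim: n => [|n IH] m //=; rewrite IH. Qed.

Lemma hdeg_kinj n (m : M) : hdeg 0 (kinj n m).
Proof. by elim: n => [|n IH] //=; left. Qed.

Lemma hdeg0_kinj n (u : kos M n) : hdeg 0 u -> u = kinj n (kproj u).
Proof. by elim: n u => [|n IH] //= [a b] /= [/IH <- ->]. Qed.

Lemma subspace_hdeg n p : subspace (@hdeg M n p).
Proof.
elim: n p => [|n IH] p.
  split=> [|c u v /=]; first by right.
  by move=> [->|->] [e|->]; [left|left|left|right; rewrite scaler0 addr0].
split=> [|c u v /= [u1 u2] [v1 v2]] /=.
  by split; [apply: subspace0 | case: p => //= p; apply: subspace0].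
split; first exact: (IH p).2.
case: p u1 u2 v1 v2 => [|p] _ u2 _ v2; first by rewrite u2 v2 scaler0 addr0.
exact: (IH p).2.
Qed.

Lemma subspace_kall (P : set M) n : subspace P -> subspace (@kall M P n).
Proof.
move=> sP; elim: n => [|n [IH0 IH]] //; split=> [|c u v [u1 u2] [v1 v2]] //=.
by split; apply: IH.
Qed.

Lemma kall_sub (P Q : set M) n (u : kos M n) :
  (forall v, P v -> Q v) -> kall P u -> kall Q u.
Proof.
by move=> PQ; elim: n u => [|n IH] u /=; [apply: PQ | move=> [/IH ? /IH]].
Qed.

Lemma kallT n (u : kos M n) : kall setT u.
Proof. by elim: n u => //= n IH u. Qed.

Lemma kall_and (P Q : set M) n (u : kos M n) :
  kall P u -> kall Q u -> kall [set v | P v /\ Q v] u.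
Proof. by elim: n u => [|n IH] u //= [a b] [c d]; split; apply: IH. Qed.

Lemma kall_eq0 n (u : kos M n) : kall [set v | v = 0] u -> u = 0.
Proof. by elim: n u => [|n IH] //= [a b] /= [/IH -> /IH ->]. Qed.

Lemma kall_kinj (P : set M) n (m : M) : P 0 -> P m -> kall P (kinj n m).
Proof.
move=> P0 Pm; elim: n => //= n IH; split=> //.
by elim: n {IH} => //= n IH.
Qed.

Lemma kall_kproj (P : set M) n (u : kos M n) : kall P u -> P (kproj u).
Proof. by elim: n u => [|n IH] //= u [/IH]. Qed.

Lemma kdiff_hdeg0 (x : nat -> {linear M -> M}) n (u : kos M n) :
  hdeg 0 u -> kdiff x u = 0.
Proof.
elim: n u => [|n IH] //= [a b] /= [/IH -> ->].
by rewrite !linear0 addr0.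
Qed.

End Maps.

Lemma kmap_comp (L M N : lmodType K) (f : M -> N) (g : N -> L) n (u : kos M n) :
  kmap g (kmap f u) = kmap (g \o f) u.
Proof. by elim: n u => [|n IH] u //=; rewrite !IH. Qed.

Section Maps2.
Variables M N : lmodType K.

Lemma eq_kmap (f g : M -> N) n (u : kos M n) :
  f =1 g -> kmap f u = kmap g u.
Proof. by move=> fg; elim: n u => [|n IH] u /=; rewrite ?fg ?IH. Qed.

Lemma eq_in_kmap (P : set M) (f g : M -> N) n (u : kos M n) :
  (forall v, P v -> f v = g v) -> kall P u -> kmap f u = kmap g u.
Proof.
by move=> fg; elim: n u => [|n IH] u /=; [apply: fg | move=> [/IH -> /IH ->]].
Qed.

Lemma kall_kmap (P : set M) (Q : set N) (f : M -> N) n (u : kos M n) :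
  (forall v, P v -> Q (f v)) -> kall P u -> kall Q (kmap f u).
Proof.
by move=> PQ; elim: n u => [|n IH] u /=; [apply: PQ | move=> [/IH ? /IH]].
Qed.

Lemma kall_kmap_inv (P : set N) (f : M -> N) n (u : kos M n) :
  kall P (kmap f u) -> kall [set v | P (f v)] u.
Proof. by elim: n u => [|n IH] u //= [/IH ? /IH]. Qed.

Lemma kproj_kmap (f : M -> N) n (u : kos M n) : kproj (kmap f u) = f (kproj u).
Proof. by elim: n u => [|n IH] u //=. Qed.

Lemma hdeg_kmap (f : {linear M -> N}) n p (u : kos M n) :
  hdeg p u -> hdeg p (kmap f u).
Proof.
elim: n p u => [|n IH] p u /=.
  by move=> [->|->]; [left | right; rewrite linear0].
move=> [h1 h2]; split; first exact: IH.
case: p {h1} h2 => [->|p /IH //].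
exact: linear0.
Qed.

Lemma kmap_kdiff (f : {linear M -> N}) (x : nat -> M -> M) (y : nat -> N -> N) n
    (u : kos M n) :
    (forall j v, (j < n)%N -> f (x j v) = y j (f v)) ->
  kmap f (kdiff x u) = kdiff y (kmap f u).
Proof.
elim: n u => [|n IH] u fxy /=; first exact: linear0.
have fxy' j v : (j < n)%N -> f (x j v) = y j (f v) by move=> /leqW; apply: fxy.
rewrite linearD linearN /= !IH // !kmap_comp; congr (_ + _, _).
by apply: eq_kmap => v; apply: fxy.
Qed.

(** Lifting of Koszul elements along a map that is surjective modulo Q. *)
Lemma kmap_lift (f : {linear M -> N}) (P Q : set N) n p (u : kos N n) :
    (forall v, P v -> exists w, Q (v - f w)) -> Q 0 ->
    kall P u -> hdeg p u ->
  exists2 w : kos M n, hdeg p w & kall Q (u - kmap f w).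
Proof.
move=> lift Q0; elim: n p u => [|n IH] p u /=.
  move=> Pu [->|->]; last by exists 0; [right | rewrite linear0 subr0].
  by have [w hw] := lift _ Pu; exists w => //; left.
move=> [P1 P2] [h1 h2]; have [a ha Qa] := IH _ _ P1 h1.
have [b hb Qb] : exists2 b : kos M n,
    (if p is p'.+1 then hdeg p' b else b = 0) & kall Q (u.2 - kmap f b).
  case: p h2 {h1 ha} => [->|p h2]; last exact: IH.
  by exists 0 => //; rewrite linear0 subr0; elim: (n) => //=.
by exists (a, b).
Qed.

End Maps2.

Section Differential.
Variables (M : lmodType K) (x : nat -> {linear M -> M}).

Lemma hdeg_kdiff n p (u : kos M n) : hdeg p.+1 u -> hdeg p (kdiff x u).
Proof.
elim: n p u => [|n IH] p u /=; first by right.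
move=> [h1 h2]; split.
  by apply: subspaceD; [apply: subspace_hdeg | apply: IH | apply: hdeg_kmap].
case: p {h1} h2 => [/kdiff_hdeg0 ->|p /IH h]; first by rewrite oppr0.
by apply: subspaceN => //; apply: subspace_hdeg.
Qed.

Lemma kall_kdiff (P Q : set M) n (u : kos M n) :
    subspace Q -> (forall j v, (j < n)%N -> P v -> Q (x j v)) ->
  kall P u -> kall Q (kdiff x u).
Proof.
move=> sQ; elim: n u => [|n IH] u PQ /=; first by move=> _; apply: subspace0.
have PQ' j v : (j < n)%N -> P v -> Q (x j v) by move=> /leqW; apply: PQ.
move=> [h1 h2]; split; last first.
  by apply: subspaceN; [apply: subspace_kall | apply: IH].
apply: subspaceD; [exact: subspace_kall | exact: IH | ].
by apply: kall_kmap h2 => v; apply: PQ.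
Qed.

Hypothesis xC : forall i j v, x i (x j v) = x j (x i v).

Lemma kdiff_kmapx n j (u : kos M n) :
  kmap (x j) (kdiff x u) = kdiff x (kmap (x j) u).
Proof. by apply: kmap_kdiff => i v _; rewrite xC. Qed.

Lemma kdiffK n (u : kos M n) : kdiff x (kdiff x u) = 0.
Proof.
elim: n u => [|n IH] u //=.
by rewrite linearD /= !IH add0r linearN /= kdiff_kmapx addrN linearN /= IH !oppr0.
Qed.

(** Exactness of the Koszul complex of a regular sequence. The set Q k is the
    submodule x_0 M + ... + x_(k-1) M. *)
Lemma koszul_exact (Q : nat -> set M) n :
    (forall v, Q 0%N v -> v = 0) ->
    (forall k v, (k < n)%N -> Q k.+1 v -> exists u, Q k (v - x k u)) ->
    (forall k v, (k < n)%N -> Q k v -> Q k.+1 v) ->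
    (forall k v, (k < n)%N -> Q k.+1 (x k v)) ->
    (forall k, (k <= n)%N -> subspace (Q k)) ->
    (forall k v, (k < n)%N -> Q k (x k v) -> Q k v) ->
  [/\ forall p (u : kos M n), hdeg p.+1 u -> kdiff x u = 0 ->
        exists2 w : kos M n, hdeg p.+2 w & u = kdiff x w,
      forall u : kos M n, Q n (kproj (kdiff x u)) &
      forall u : kos M n, hdeg 0 u -> Q n (kproj u) ->
        exists2 w : kos M n, hdeg 1 w & u = kdiff x w].
Proof.
move=> Q0; elim: n => [|n IH] QS Qle Qx sQ reg.
  split=> [p u [//|->] _|u|u _ /Q0 /= ->].
  - by exists 0; [right | ].
  - by apply: subspace0; apply: sQ.
  - by exists 0; [right | ].
have [|||||ex img ex0] := IH.
- by move=> k v /leqW; apply: QS.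
- by move=> k v /leqW; apply: Qle.
- by move=> k v /leqW; apply: Qx.
- by move=> k /leqW; apply: sQ.
- by move=> k v /leqW; apply: reg.
split.
- move=> p [a b] /= [ha hb] [dab /eqP]; rewrite oppr_eq0 => /eqP db.
  (* Since b is a boundary, the pair (a, b) is homologous to some (a', 0). *)
  have [b' hb' eb] : exists2 b' : kos M n, hdeg p.+1 b' & b = kdiff x b'.
    case: p ha hb => [|p] ha hb; last exact: ex.
    apply: ex0 => //; apply: reg => //.
    have := img (- a); rewrite linearN /=.
    have -> : - kdiff x a = kmap (x n) b by apply/esym/eqP; rewrite -addr_eq0 addrC dab.
    by rewrite kproj_kmap.
  have [||a' ha' ea] := ex p (a + kmap (x n) b').
    by apply: subspaceD => //; [apply: subspace_hdeg | apply: hdeg_kmap].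
    by rewrite linearD /= -kdiff_kmapx -eb.
  exists (a', - b'); first by split=> //=; apply: subspaceN => //; apply: subspace_hdeg.
  by rewrite /= -ea !linearN /= addrK opprK eb.
- move=> u /=; rewrite linearD /=; apply: subspaceD; first exact: sQ.
    exact: (Qle _ _ (ltnSn n) (img _)).
  by rewrite kproj_kmap; apply: Qx.
- move=> [a b] /= [ha ->] /(QS _ _ (ltnSn n)) [m Qm].
  have [||w hw ew] := ex0 (a - kinj n (x n m)).
  + apply: subspaceB => //; [exact: subspace_hdeg | exact: hdeg_kinj].
  + by rewrite linearB /= kinjK.
  exists (w, kinj n m); first by split=> //=; apply: hdeg_kinj.
  rewrite /= -ew (kdiff_hdeg0 _ (hdeg_kinj n m)) oppr0; congr (_, _).
  suff -> : kmap (x n) (kinj n m) = kinj n (x n m) by rewrite subrK.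
  by rewrite [LHS]hdeg0_kinj ?kproj_kmap ?kinjK //; apply/hdeg_kmap/hdeg_kinj.
Qed.

End Differential.
End KoszulModule.

(** * Graded modules and Koszul homology *)

Section GradedModules.
Variable K : fieldType.

(** A graded module over a polynomial ring, seen as a graded vector space with
    commuting endomorphisms of degree 1. The maps gproj e are the projections
    onto the homogeneous components. *)
Record gmod := GMod {
  gcar :> lmodType K;
  gx : nat -> {linear gcar -> gcar};
  gdeg : nat -> set gcar;
  gproj : nat -> {linear gcar -> gcar};
  gxC : forall i j v, gx i (gx j v) = gx j (gx i v);
  subspace_gdeg : forall e, subspace (gdeg e);
  gprojP : forall e v, gdeg e (gproj e v);
  gprojE : forall e e' v, gdeg e v -> gproj e' v = if e == e' then v else 0;
  gdecomp : forall v, exists N, v = \sum_(e < N) gproj e v;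
  gx_deg : forall j e v, gdeg e v -> gdeg e.+1 (gx j v)
}.

(** Homogeneous maps of degree 0 that commute with the variables. *)
Definition graded_map (A B : gmod) (f : A -> B) : Prop :=
  (forall j v, f (gx A j v) = gx B j (f v)) /\
  (forall e v, gdeg e v -> gdeg e (f v)).

Lemma gproj_shift (A B : gmod) (f : {linear A -> B}) s :
    (forall e v, gdeg e v -> gdeg (e + s) (f v)) ->
  forall e v, gproj B (e + s) (f v) = f (gproj A e v).
Proof.
move=> df e v; have [N ev] := gdecomp v.
rewrite {1}ev {2}ev !linear_sum; apply: eq_bigr => k _ /=.
rewrite (gprojE _ (df _ _ (gprojP _ _))) (gprojE _ (gprojP _ _)) eqn_add2r.
by case: eqP => // _; rewrite linear0.
Qed.

Lemma gproj_map (A B : gmod) (f : {linear A -> B}) e v :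
  graded_map f -> gproj B e (f v) = f (gproj A e v).
Proof.
move=> [_ df]; rewrite -[e in LHS]addn0; apply: gproj_shift => k u.
by rewrite addn0; apply: df.
Qed.

Lemma gproj_x (A : gmod) j e v : gproj A e.+1 (gx A j v) = gx A j (gproj A e v).
Proof.
by rewrite -addn1; apply: gproj_shift => k u; rewrite addn1; apply: gx_deg.
Qed.

Lemma gproj_id (A : gmod) e v : gdeg e v -> gproj A e v = v.
Proof. by move/gprojE ->; rewrite eqxx. Qed.

Section Homology.
Variables (n : nat) (A : gmod).
Implicit Type W : set A.

Local Notation d := (kdiff (gx A)).

(** The Koszul homology of A / W in homological degree p and internal degree
    p + e: coefficients of cycles have degree e, because an exterior monomial
    of homological degree p has internal degree p. *)
Definition kcyc W p e : set (kos A n) :=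
  [set z | [/\ hdeg p z, kall (gdeg e) z & kall W (d z)]].

Definition kbnd W p : set (kos A n) :=
  [set z | exists2 w, hdeg p.+1 w & kall W (z - d w)].

Lemma subspace_kcyc W p e : subspace W -> subspace (kcyc W p e).
Proof.
move=> sW; split=> [|c u v [u1 u2 u3] [v1 v2 v3]].
  split; [exact: subspace0 (subspace_hdeg _ _ _) | |].
    exact: subspace0 (subspace_kall _ (subspace_gdeg _ _)).
  by rewrite linear0; apply: subspace0; apply: subspace_kall.
split; first exact: (subspace_hdeg _ _ _).2.
  exact: (subspace_kall _ (subspace_gdeg _ _)).2.
by rewrite linearP; apply: (subspace_kall _ _).2.
Qed.

Lemma subspace_kbnd W p : subspace W -> subspace (kbnd W p).
Proof.
move=> sW; split=> [|c u v [w1 h1 W1] [w2 h2 W2]].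
  exists 0; first exact: subspace0 (subspace_hdeg _ _ _).
  by rewrite linear0 subr0; apply: subspace0; apply: subspace_kall.
exists (c *: w1 + w2); first exact: (subspace_hdeg _ _ _).2.
rewrite linearP opprD addrACA -scalerBr; exact: (subspace_kall _ _).2.
Qed.

Lemma kdiffK_gx (u : kos A n) : d (d u) = 0.
Proof. by apply: kdiffK => i j v; apply: gxC. Qed.

Lemma kdiff_sub_bnd (u w : kos A n) : d (u - d w) = d u.
Proof. by rewrite linearB /= kdiffK_gx subr0. Qed.

Lemma kmap_gproj_id e (u : kos A n) : kall (gdeg e) u -> kmap (gproj A e) u = u.
Proof.
move=> du; rewrite (eq_in_kmap (g := id) (P := gdeg e)) // => [|v /gproj_id //].
by elim: n u {du} => [|m IH] u //=; rewrite !IH; case: u.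
Qed.

Lemma kmap_gprojP e (u : kos A n) : kall (gdeg e) (kmap (gproj A e) u).
Proof. by apply: kall_kmap (kallT u) => v _; apply: gprojP. Qed.

Lemma kdiff_gproj e (u : kos A n) :
  d (kmap (gproj A e) u) = kmap (gproj A e.+1) (d u).
Proof.
elim: n u => [|m IH] u /=; first by rewrite linear0.
rewrite linearD linearN /= !IH; congr (_ + _, _).
by rewrite !kmap_comp; apply: eq_kmap => v /=; rewrite gproj_x.
Qed.

Lemma kall_gx_kdiff e (u : kos A n) :
  kall (gdeg e) u -> kall (gdeg e.+1) (d u).
Proof.
move=> h; apply: kall_kdiff h; first exact: subspace_gdeg.
by move=> j v _; apply: gx_deg.
Qed.

End Homology.

Section GradedMap.
Variables (n : nat) (A B : gmod) (f : {linear A -> B}).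
Hypothesis gf : graded_map f.

Lemma kmap_gx (u : kos A n) : kmap f (kdiff (gx A) u) = kdiff (gx B) (kmap f u).
Proof. by apply: kmap_kdiff => j v _; apply: gf.1. Qed.

Lemma kmap_gproj e (u : kos A n) :
  kmap f (kmap (gproj A e) u) = kmap (gproj B e) (kmap f u).
Proof. by rewrite !kmap_comp; apply: eq_kmap => v /=; rewrite gproj_map. Qed.

(** If f induces an isomorphism A / f^-1 J --> B / J, it induces isomorphisms
    in Koszul homology. *)
Lemma koszul_iso (W : set A) (J : set B) p e d :
    subspace J -> (forall k v, J v -> J (gproj B k v)) ->
    (forall j v, J v -> J (gx B j v)) ->
    (forall a, W a <-> J (f a)) ->
    (forall b, exists a, J (b - f a)) ->
  has_qdim (@kcyc n A W p e) (kbnd W p) d <->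
  has_qdim (@kcyc n B J p e) (kbnd J p) d.
Proof.
move=> sJ pJ xJ WJ onto.
have sW : subspace W.
  have [h0 h] := subspace_preim f sJ.
  by split=> [|c u v /WJ hu /WJ hv]; apply/WJ; [exact: h0 | apply: h].
have sJn := subspace_kall n sJ.
have dJ (u : kos B n) : kall J u -> kall J (kdiff (gx B) u).
  by apply: kall_kdiff => // j v _; apply: xJ.
have WJn (u : kos A n) : kall W u <-> kall J (kmap f u).
  split; first by apply: kall_kmap => v /WJ.
  by move/kall_kmap_inv; apply: kall_sub => v /WJ.
apply: (has_qdim_corr_iff (R := fun z m => kall J (m - kmap f z))).
- exact: subspace_kcyc.
- exact: subspace_kcyc.
- by rewrite linear0 subr0; apply: subspace0.
- move=> c u v u' v' h1 h2.
  by rewrite linearP opprD addrACA -scalerBr; apply: sJn.2.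
- move=> z [h1 h2 h3]; exists (kmap f z); last by rewrite subrr; apply: subspace0.
  split; [exact: hdeg_kmap | by apply: kall_kmap h2; apply: gf.2 |].
  by rewrite -kmap_gx; apply: kall_kmap h3 => v /WJ.
- move=> m [h1 h2 h3].
  have [z hz Jz] := kmap_lift (f := f) (fun b _ => onto b) (subspace0 sJ) (kallT m) h1.
  have Jz' : kall J (m - kmap f (kmap (gproj A e) z)).
    rewrite kmap_gproj -{1}(kmap_gproj_id h2) -linearB /=.
    by apply: kall_kmap Jz => v; apply: pJ.
  exists (kmap (gproj A e) z) => //; split; first exact: hdeg_kmap.
    exact: kmap_gprojP.
  apply/WJn; rewrite kmap_gx.
  by apply/(subspace_congr sJn (u := kdiff (gx B) m)); rewrite // -linearB; apply: dJ.
- move=> z m _ _ Jmz; split=> [[w hw Ww]|[m' hm' Jm]].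
    exists (kmap f w); first exact: hdeg_kmap.
    rewrite -(subrK (kmap f z) m) -addrA -kmap_gx -linearB.
    by apply: subspaceD => //; apply/WJn.
  have [w hw Jw] := kmap_lift (f := f) (fun b _ => onto b) (subspace0 sJ) (kallT m') hm'.
  exists w => //; apply/WJn; rewrite linearB /= kmap_gx.
  apply/(subspace_congr sJn (u := m - kdiff (gx B) m')); last exact: Jm.
  have -> : m - kdiff (gx B) m' - (kmap f z - kdiff (gx B) (kmap f w)) =
      m - kmap f z - kdiff (gx B) (m' - kmap f w).
    rewrite [kdiff _ (m' - _)]linearB /= !opprB.
    by rewrite addrACA [RHS]addrACA [- _ - _]addrC.
  by apply: subspaceB => //; apply: dJ.
Qed.

End GradedMap.

End GradedModules.

(** * Dimension shifting along free modules *)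

Section DimensionShift.
Variables (K : fieldType) (n : nat).

(** A graded module A whose Koszul homology on n variables is concentrated in
    homological degree 0, where it is the graded vector space V; for a free
    module over K[x_1, ..., x_n], V is its fibre at the origin. The map fib is the
    projection onto V, and lft is a section of it. *)
Record acyclic (A : gmod K) (V : lmodType K) := Acyclic {
  fib : {linear A -> V};
  lft : V -> A;
  fdeg : nat -> set V;
  lftK : forall v, fib (lft v) = v;
  fib_deg : forall e a, gdeg e a -> fdeg e (fib a);
  lft_deg : forall e v, fdeg e v -> gdeg e (lft v);
  acyclicP : forall p (u : kos A n), hdeg p.+1 u -> kdiff (gx A) u = 0 ->
    exists2 w : kos A n, hdeg p.+2 w & u = kdiff (gx A) w;
  fib_kdiff : forall u : kos A n, fib (kproj (kdiff (gx A) u)) = 0;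
  acyclic0 : forall u : kos A n, hdeg 0 u -> fib (kproj u) = 0 ->
    exists2 w : kos A n, hdeg 1 w & u = kdiff (gx A) w
}.

Section Fibre.
Variables (A B : gmod K) (V V' : lmodType K).
Variables (cA : acyclic A V) (cB : acyclic B V').
Variables (g : {linear B -> A}) (T : {linear V' -> V}).
Hypothesis gT : forall b, fib cA (g b) = T (fib cB b).

Variable (W : set A).
Hypothesis sW : subspace W.
Hypothesis Wg : forall a, W a <-> exists b, a = g b.

(** The Koszul homology of A / g(B) in homological degree 0 is the cokernel of
    the map that g induces on fibres; P cuts out a subspace. *)
Lemma koszul_fibre (P : set V) e d :
    subspace P ->
  has_qdim [set z : kos A n | kcyc W 0 e z /\ P (fib cA (kproj z))] (kbnd W 0) d <->
  has_qdim [set v | fdeg cA e v /\ P v] [set v | exists u, v = T u] d.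
Proof.
move=> sP.
have sdeg : subspace (fdeg cA e).
  have sA := subspace_gdeg A e.
  split=> [|c u v hu hv].
    by rewrite -(linear0 (fib cA)); apply/fib_deg/(subspace0 sA).
  rewrite -(lftK cA u) -(lftK cA v) -linearP; apply: fib_deg.
  by apply: sA.2; apply: lft_deg.
apply: (has_qdim_corr_iff (R := fun z v => fib cA (kproj z) = v)).
- apply: subspaceI; first exact: subspace_kcyc.
  have [h0 h] := sP; split=> [|c u v hu hv] /=; first by rewrite !linear0.
  by rewrite !linearP; apply: h.
- exact: subspaceI.
- by rewrite !linear0.
- by move=> c u v u' v' <- <-; rewrite !linearP.
- move=> z [[h1 h2 h3] Pz]; exists (fib cA (kproj z)) => //; split=> //.
  by apply: fib_deg; apply: kall_kproj h2.
- move=> v [hv Pv]; exists (kinj n (lft cA v)); last by rewrite kinjK lftK.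
  split; last by rewrite /= kinjK lftK.
  split; [exact: hdeg_kinj | apply: kall_kinj; last exact: lft_deg |].
    by apply: subspace0; apply: subspace_gdeg.
  rewrite kdiff_hdeg0; last exact: hdeg_kinj.
  by apply: subspace0; apply: subspace_kall.
- move=> z v [[hz _ _] _] _ <-; split=> [[w hw Ww]|[u eu]].
  have /Wg [b eb] := kall_kproj Ww.
    exists (fib cB b); rewrite -gT -eb linearB linearB /=.
    by rewrite fib_kdiff subr0.
  have [||w hw ew] := @acyclic0 _ _ cA (z - kinj n (g (lft cB u))).
  + by apply: subspaceB; [apply: subspace_hdeg | | apply: hdeg_kinj].
  + by rewrite linearB linearB /= kinjK gT lftK eu subrr.
  exists w => //; rewrite -ew subKr; apply: kall_kinj; first exact: subspace0.
  by apply/Wg; eexists.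
Qed.

End Fibre.

(** The exact sequence 0 --> B / W' --> A --> A / W --> 0, with A acyclic,
    shifts Koszul homology. In homological degree 0, the kernel of the map from
    B / (x) B to the fibre of A appears. *)
Lemma koszul_shift (A B : gmod K) (V : lmodType K) (cA : acyclic A V)
    (f : {linear B -> A}) (W : set A) (W' : set B) p e d :
    graded_map f -> subspace W -> subspace W' ->
    (forall a, W a <-> exists b, a = f b) ->
    (forall b, W' b <-> f b = 0) ->
  has_qdim (@kcyc K n A W p.+1 e) (kbnd W p.+1) d <->
  has_qdim [set y : kos B n | kcyc W' p e.+1 y /\
              (p = 0%N -> fib cA (f (kproj y)) = 0)] (kbnd W' p) d.
Proof.
move=> gf sW sW' Wf Wf'.
have ker0 (y : kos B n) : kall W' y <-> kmap f y = 0.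
  split=> [h|h].
    by apply: kall_eq0; apply: kall_kmap h => v /Wf'.
  have: kall [set v | v = 0] (kmap f y).
    rewrite h; apply: subspace0; apply: subspace_kall.
    by split=> // c u v -> ->; rewrite scaler0 addr0.
  by move/kall_kmap_inv; apply: kall_sub => v /Wf'.
have lift q (z : kos A n) : hdeg q z -> kall W z ->
    exists2 y : kos B n, hdeg q y & z = kmap f y.
  move=> hz Wz; have [||y hy ey] := kmap_lift (f := f) (Q := [set v | v = 0]) _ _ Wz hz => //.
    by move=> v /Wf [b ->]; exists b; rewrite /= subrr.
  by exists y => //; apply/eqP; rewrite -subr_eq0; apply/eqP/kall_eq0.
apply: (has_qdim_corr_iff (R := fun z y => kdiff (gx A) z = kmap f y)).
- exact: subspace_kcyc.
- apply: subspaceI; first exact: subspace_kcyc.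
  split=> [|c u v hu hv /= p0]; first by rewrite !linear0.
  by rewrite !linearP /= (hu p0) (hv p0) scaler0 addr0.
- by rewrite !linear0.
- by move=> c u v u' v' h1 h2; rewrite !linearP /= h1 h2.
- move=> z [h1 h2 h3].
  have [y0 hy0 ey0] := lift _ _ (hdeg_kdiff (gx A) h1) h3.
  pose y := kmap (gproj B e.+1) y0.
  have ey : kdiff (gx A) z = kmap f y.
    by rewrite kmap_gproj // -ey0 kmap_gproj_id //; apply: kall_gx_kdiff.
  exists y => //; split; last first.
    by move=> p0; rewrite -kproj_kmap -ey fib_kdiff.
  split; [exact: hdeg_kmap | exact: kmap_gprojP |].
  by apply/ker0; rewrite kmap_gx // -ey kdiffK_gx.
- move=> y [[h1 h2 h3] h4].
  have dy : kdiff (gx A) (kmap f y) = 0 by rewrite -kmap_gx //; apply/ker0.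
  have hy : hdeg p (kmap f y) by apply: hdeg_kmap.
  have [z hz ez] : exists2 z : kos A n, hdeg p.+1 z & kmap f y = kdiff (gx A) z.
    case: p hy h4 {h1} => [|p] hy h4; last exact: (acyclicP cA hy dy).
    by apply: (@acyclic0 _ _ cA _ hy); rewrite kproj_kmap h4.
  have ez' : kdiff (gx A) (kmap (gproj A e) z) = kmap f y.
    by rewrite kdiff_gproj -ez -kmap_gproj // kmap_gproj_id.
  exists (kmap (gproj A e) z) => //; split; [exact: hdeg_kmap | exact: kmap_gprojP |].
  by rewrite ez'; apply: kall_kmap (kallT y) => b _; apply/Wf; exists b.
- move=> z y [hz _ _] [[hy _ _] _] ezy; split=> [[w hw Ww]|[w hw Ww]].
    have [|y' hy' ey'] := lift p.+1 _ _ Ww.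
      apply: subspaceB => //; [exact: subspace_hdeg | exact: hdeg_kdiff].
    exists y' => //; apply/ker0; rewrite linearB /= kmap_gx // -ey' -ezy.
    by rewrite linearB /= kdiffK_gx subr0 subrr.
  have [||w' hw' ew'] := @acyclicP _ _ cA p (z - kmap f w).
  + by apply: subspaceB; [apply: subspace_hdeg | | apply: hdeg_kmap].
  + by move/ker0: Ww; rewrite !linearB /= kmap_gx // ezy.
  exists w' => //; rewrite -ew' subKr.
  by apply: kall_kmap (kallT w) => b _; apply/Wf; exists b.
Qed.

(** Balancing of Tor: for a complex ... --> A_1 --> A_0 of acyclic modules that
    is exact in positive degrees, the Koszul homology of the cokernels is the
    homology of the complex of fibres. *)
Section Balance.
Variables (A : nat -> gmod K) (V : nat -> lmodType K).
Variable (c : forall i, acyclic (A i) (V i)).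
Variables (f : forall i, {linear A i.+1 -> A i}).
Variables (T : forall i, {linear V i.+1 -> V i}).
Hypothesis gf : forall i, graded_map (f i).
Hypothesis fT : forall i b, fib (c i) (f i b) = T i (fib (c i.+1) b).
Hypothesis exf : forall i v, f i v = 0 <-> exists w, v = f i.+1 w.

(** The image of f i; its cokernel is the i-th syzygy module. *)
Let im i : set (A i) := [set a | exists b, a = f i b].

(** The cycles of the complex of fibres. *)
Definition fibre_cyc i : set (V i) :=
  match i with
  | 0 => setT
  | i'.+1 => [set v | T i' v = 0]
  end.

(** The dimension of the homology of the complex of fibres, in homological
    degree i and internal degree k. *)
Definition fibre_qdim i k :=
  has_qdim [set v | fdeg (c i) k v /\ fibre_cyc v] [set v | exists u, v = T i u].

Lemma subspace_im i : subspace (@im i).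
Proof.
split=> [|a u v [b ->] [b' ->]]; first by exists 0; rewrite linear0.
by exists (a *: b + b'); rewrite linearP.
Qed.

Lemma koszul_tor_shift p q e d :
  has_qdim (@kcyc K n (A q) (@im q) p.+1 e) (kbnd (@im q) p.+1) d <->
  fibre_qdim (q + p.+1) (e + p.+1) d.
Proof.
have im0 q' b : @im q'.+1 b <-> f q' b = 0 by rewrite exf.
elim: p q e => [|p IH] q e.
  rewrite !addn1 (koszul_shift (c q) _ _ _ (gf q) (@subspace_im q) (@subspace_im q.+1)) //.
  rewrite /fibre_qdim.
  rewrite -(koszul_fibre (@fT q.+1) (@subspace_im q.+1) (fun=> iff_refl _)
                         (P := [set v | T q v = 0])).
    apply: eq_has_qdim => // z; split=> [[h /(_ erefl)]|[h1 h2]].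
      by rewrite fT.
    by split=> // _; rewrite fT.
  split=> [|a u v /= hu hv] /=; first by rewrite linear0.
  by rewrite linearP hu hv scaler0 addr0.
rewrite -(addSnnS q) -(addSnnS e) -IH.
rewrite (koszul_shift (c q) _ _ _ (gf q) (@subspace_im q) (@subspace_im q.+1)) //.
by apply: eq_has_qdim => // z; split=> [[]|].
Qed.

Lemma koszul_tor0 e d :
  has_qdim (@kcyc K n (A 0) (@im 0) 0 e) (kbnd (@im 0) 0) d <-> fibre_qdim 0 e d.
Proof.
rewrite /fibre_qdim -(koszul_fibre (@fT 0) (@subspace_im 0) (fun=> iff_refl _) (P := setT)) //.
by apply: eq_has_qdim => // z; split=> [|[]].
Qed.

End Balance.
End DimensionShift.

(** * Polynomials and free modules *)

Section Polynomials.
Variables (K : fieldType) (l : nat).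
Implicit Types (p q : {mpoly K[l]}) (t : 'X_{1..l}).

Lemma mcoeff_geq_msize p t : (msize p <= mdeg t)%N -> p@_t = 0.
Proof. by move/msize_mdeg_ge; rewrite mcoeff_msupp negbK => /eqP. Qed.

Lemma mcoeff_mpoly_trunc (E : 'X_{1..l} -> K) k t :
  (\sum_(u : 'X_{1..l < k}) E u *: 'X_[u])@_t = if (mdeg t < k)%N then E t else 0.
Proof.
case: ltnP => [|le_kt]; first exact: mcoeff_mpoly.
rewrite raddf_sum big1 // => u _ /=; rewrite mcoeffZ mcoeffX.
case: eqP => [ut|]; rewrite ?mulr0 //.
by have := bmdeg u; rewrite ut ltnNge le_kt.
Qed.

Lemma mcoeff_Xmul (i : 'I_l) p t :
  ('X_i * p)@_t = if t i == 0%N then 0 else p@_(t - U_(i)).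
Proof.
case: eqP => [ti0|/eqP ti].
  apply/eqP; rewrite mcoeff_eq0; apply/negP => /msuppM_le /allpairsP [[u v]] /=.
  rewrite msuppX inE => -[/eqP -> _ tE]; move: ti0.
  by rewrite tE mnmDE mnm1E eqxx.
have {1}-> : t = (U_(i) + (t - U_(i)))%MM by rewrite addmC submK // lep1mP.
by rewrite mulrC mcoeffMX.
Qed.

(** The part of p of degree e, when the degree of 1 is s. *)
Definition hcomp (s e : nat) p : {mpoly K[l]} :=
  \sum_(u : 'X_{1..l < msize p}) (if (s + mdeg u == e)%N then p@_u else 0) *: 'X_[u].

Lemma mcoeff_hcomp s e p t :
  (hcomp s e p)@_t = if (s + mdeg t == e)%N then p@_t else 0.
Proof.
rewrite /hcomp (mcoeff_mpoly_trunc (fun u => if (s + mdeg u == e)%N then p@_u else 0)).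
by case: ltnP => // /mcoeff_geq_msize ->; case: ifP.
Qed.

(** The polynomial whose coefficient at t is that of p at h t. *)
Definition mpull m (h : 'X_{1..m} -> 'X_{1..l}) p : {mpoly K[m]} :=
  \sum_(u : 'X_{1..m < msize p}) p@_(h u) *: 'X_[u].

(** The quotient of p by the variable i. *)
Definition mdivx (i : 'I_l) := mpull (fun t => t + U_(i))%MM.

(** The j-th variable, or 0 when j is too large. *)
Definition xvar (j : nat) : {mpoly K[l]} := oapp (fun i : 'I_l => 'X_i) 0 (insub j).

Lemma xvarE (i : 'I_l) : xvar i = 'X_i.
Proof. by rewrite /xvar valK. Qed.

Lemma xvar0 j : (l <= j)%N -> xvar j = 0.
Proof. by move=> le_lj; rewrite /xvar insubF // ltnNge le_lj. Qed.

(** Multiplication by the j-th variable. *)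
Definition xmul j (p : {mpoly K[l]}) : {mpoly K[l]} := xvar j * p.

Lemma xmul_is_linear j : linear (xmul j).
Proof. by move=> c p q; rewrite /xmul mulrDr scalerAr. Qed.

HB.instance Definition _ j :=
  GRing.isLinear.Build K {mpoly K[l]} {mpoly K[l]} _ (xmul j) (xmul_is_linear j).

Lemma hcomp_is_linear s e : linear (hcomp s e).
Proof.
move=> c p q; apply/mpolyP => t.
by rewrite mcoeffD mcoeffZ !mcoeff_hcomp mcoeffD mcoeffZ; case: ifP; rewrite ?mulr0 ?addr0.
Qed.

HB.instance Definition _ s e :=
  GRing.isLinear.Build K {mpoly K[l]} {mpoly K[l]} _ (hcomp s e) (hcomp_is_linear s e).

(** Homogeneity of degree e, when the degree of 1 is s. *)
Definition shomog (s e : nat) : set {mpoly K[l]} :=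
  [set p | forall t, t \in msupp p -> (s + mdeg t = e)%N].

Lemma shomogP s e p :
  shomog s e p <-> forall t, (s + mdeg t != e)%N -> p@_t = 0.
Proof.
split=> [h t|h t].
  by move=> /eqP ne; apply/eqP; rewrite mcoeff_eq0; apply/negP => /h.
by rewrite mcoeff_msupp => nz; apply/eqP; apply: contraNT nz => /h ->.
Qed.

Lemma subspace_shomog s e : subspace (shomog s e).
Proof.
split=> [|c p q /shomogP hp /shomogP hq]; apply/shomogP => t ne.
  exact: mcoeff0.
by rewrite mcoeffD mcoeffZ hp // hq // mulr0 addr0.
Qed.

Lemma shomog_hcomp s e p : shomog s e (hcomp s e p).
Proof. by apply/shomogP => t ne; rewrite mcoeff_hcomp (negbTE ne). Qed.

Lemma hcomp_shomog s e e' p :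
  shomog s e p -> hcomp s e' p = if e == e' then p else 0.
Proof.
move/shomogP => hp; apply/mpolyP => t; rewrite mcoeff_hcomp.
have [<-|ne] := eqVneq e e'; first by case: eqP => // /eqP /hp ->.
rewrite mcoeff0; case: eqP => // te; apply: hp.
by rewrite te eq_sym.
Qed.

Lemma hcomp_sum s p N :
  (s + msize p <= N)%N -> p = \sum_(e < N) hcomp s e p.
Proof.
move=> le_pN; apply/mpolyP => t; rewrite raddf_sum /=.
have [lt_tN|le_Nt] := ltnP (s + mdeg t) N.
  rewrite (bigD1 (Ordinal lt_tN)) //= mcoeff_hcomp eqxx big1 ?addr0 // => e ne.
  rewrite mcoeff_hcomp; case: (eqVneq (s + mdeg t)%N e) => // te.
  by case/negP: ne; apply/eqP; apply: val_inj; rewrite /= te.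
have pt : p@_t = 0.
  by apply: mcoeff_geq_msize; rewrite -(leq_add2l s); apply: leq_trans le_Nt.
by rewrite pt big1 // => e _; rewrite mcoeff_hcomp pt if_same.
Qed.

Lemma shomog_xmul s j e p : shomog s e p -> shomog s e.+1 (xmul j p).
Proof.
move=> /shomogP hp; apply/shomogP => t ne; rewrite /xmul.
have [lt_jl|le_lj] := ltnP j l; last by rewrite xvar0 // mul0r mcoeff0.
rewrite (xvarE (Ordinal lt_jl)) mcoeff_Xmul; case: eqP => // /eqP nz; apply: hp.
apply: contraNneq ne => <-; rewrite -addnS; apply/eqP; congr (_ + _)%N.
by rewrite -{1}(submK (m := U_(Ordinal lt_jl)) (m' := t)) ?lep1mP // mdegD mdeg1 addn1.
Qed.

Lemma xmulC i j p : xmul i (xmul j p) = xmul j (xmul i p).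
Proof. by rewrite /xmul mulrCA. Qed.

(** The polynomial ring as a graded module. *)
Definition poly_gmod : gmod K :=
  @GMod K {mpoly K[l]} (fun j => xmul j) (shomog 0) (fun e => hcomp 0 e)
    xmulC (subspace_shomog 0) (@shomog_hcomp 0) (@hcomp_shomog 0)
    (fun p => ex_intro _ _ (hcomp_sum (leqnn (0 + msize p)%N)))
    (@shomog_xmul 0).

End Polynomials.

Section Pullback.
Variables (K : fieldType) (l m : nat) (h : 'X_{1..m} -> 'X_{1..l}).
Hypothesis le_h : forall t, (mdeg t <= mdeg (h t))%N.

Lemma mcoeff_mpull (p : {mpoly K[l]}) t : (mpull h p)@_t = p@_(h t).
Proof.
rewrite /mpull (mcoeff_mpoly_trunc (fun u => p@_(h u))); case: ltnP => // le_pt.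
by rewrite mcoeff_geq_msize // (leq_trans le_pt).
Qed.

End Pullback.

Lemma mcoeff_mdivx (K : fieldType) l (i : 'I_l) (p : {mpoly K[l]}) t :
  (mdivx i p)@_t = p@_(t + U_(i)).
Proof. by rewrite mcoeff_mpull // => u; rewrite mdegD leq_addr. Qed.

(** * Free modules of finite rank *)

(** Rows of polynomials, as a vector space over the field of coefficients. *)
Definition prow (K : fieldType) (l r : nat) : Type := 'rV[{mpoly K[l]}]_r.

HB.instance Definition _ (K : fieldType) l r :=
  GRing.Zmodule.copy (prow K l r) 'rV[{mpoly K[l]}]_r.

Section FreeModules.
Variables (K : fieldType) (l : nat).

Section Scale.
Variable r : nat.
Implicit Types u v : prow K l r.

Definition prow_scale (c : K) u : prow K l r := c%:MP *: (u : 'rV_r).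

Fact prow_scaleA a b v : prow_scale a (prow_scale b v) = prow_scale (a * b) v.
Proof. by rewrite /prow_scale scalerA mpolyCM. Qed.
Fact prow_scale1 : left_id 1 prow_scale.
Proof. by move=> v; rewrite /prow_scale mpolyC1 scale1r. Qed.
Fact prow_scaleDr : right_distributive prow_scale +%R.
Proof. by move=> c u v; rewrite /prow_scale scalerDr. Qed.
Fact prow_scaleDl v : {morph prow_scale^~ v : a b / a + b}.
Proof. by move=> a b; rewrite /prow_scale mpolyCD scalerDl. Qed.

HB.instance Definition _ :=
  GRing.Zmodule_isLmodule.Build K (prow K l r)
    prow_scaleA prow_scale1 prow_scaleDr prow_scaleDl.

Lemma prowE c u v m : (c *: u + v : prow K l r) 0 m = c *: u 0 m + v 0 m.
Proof. by rewrite mxE mxE mul_mpolyC. Qed.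

(** A K-linear map acting on all entries. *)
Definition row_map (f : 'I_r -> {mpoly K[l]} -> {mpoly K[l]}) u : prow K l r :=
  \row_m f m (u 0 m).

Lemma row_map_is_linear (f : 'I_r -> {linear {mpoly K[l]} -> {mpoly K[l]}}) :
  linear (row_map f).
Proof. by move=> c u v; apply/rowP => m; rewrite prowE [LHS]mxE prowE linearP !mxE. Qed.

HB.instance Definition _ (f : 'I_r -> {linear {mpoly K[l]} -> {mpoly K[l]}}) :=
  GRing.isLinear.Build K (prow K l r) (prow K l r) _ (row_map f)
    (row_map_is_linear f).

(** The fibre at the origin. *)
Definition row_fib (u : prow K l r) : 'rV[K]_r := map_mx (mcoeff 0%MM) u.

Lemma row_fib_is_linear : linear row_fib.
Proof.
by move=> c u v; apply/rowP => m; rewrite [LHS]mxE prowE mcoeffD mcoeffZ !mxE.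
Qed.

HB.instance Definition _ :=
  GRing.isLinear.Build K (prow K l r) 'rV[K]_r _ row_fib row_fib_is_linear.

Variable a : 'I_r -> nat.

(** The rows of degree e, when the basis has degrees a. *)
Definition row_deg e : set (prow K l r) := row_homog a e.

Lemma row_degP e u : row_deg e u <-> forall m, shomog (a m) e (u 0 m).
Proof. by []. Qed.

Lemma subspace_row_deg e : subspace (row_deg e).
Proof.
split=> [|c u v hu hv]; apply/row_degP => m.
  by rewrite mxE; apply: subspace0; apply: subspace_shomog.
by rewrite prowE; apply: (subspace_shomog K l (a m) e).2; [apply: hu | apply: hv].
Qed.

(** The homogeneous component of degree e. *)
Definition row_proj e : prow K l r -> prow K l r := row_map (fun m => hcomp (a m) e).

HB.instance Definition _ e := GRing.Linear.on (row_proj e).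

Lemma row_deg_proj e u : row_deg e (row_proj e u).
Proof. by apply/row_degP => m; rewrite mxE; apply: shomog_hcomp. Qed.

Lemma row_proj_deg e e' u :
  row_deg e u -> row_proj e' u = if e == e' then u else 0.
Proof.
move=> /row_degP hu; apply/rowP => m; rewrite mxE (hcomp_shomog _ (hu m)).
by case: eqP => // _; rewrite mxE.
Qed.

Lemma row_proj_sum u : exists N, u = \sum_(e < N) row_proj e u.
Proof.
pose N := (\max_m (a m + msize (u 0%R m)))%N.
exists N; apply/rowP => m; rewrite summxE.
under eq_bigr do rewrite mxE.
by apply: hcomp_sum; apply: (leq_bigmax m).
Qed.

Definition row_xmul j : prow K l r -> prow K l r := row_map (fun=> @xmul K l j).

HB.instance Definition _ j := GRing.Linear.on (row_xmul j).

Lemma row_xmulC i j u : row_xmul i (row_xmul j u) = row_xmul j (row_xmul i u).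
Proof. by apply/rowP => m; rewrite !mxE xmulC. Qed.

Lemma row_deg_xmul j e u : row_deg e u -> row_deg e.+1 (row_xmul j u).
Proof. by move=> /row_degP hu; apply/row_degP => m; rewrite mxE; apply: shomog_xmul. Qed.

(** The graded free module with a basis of degrees a. *)
Definition row_gmod : gmod K :=
  @GMod K (prow K l r) (fun j => row_xmul j) row_deg (fun e => row_proj e)
    row_xmulC subspace_row_deg row_deg_proj row_proj_deg row_proj_sum row_deg_xmul.

(** The rows with entries in the ideal of the first k variables. *)
Definition row_ideal (k : nat) : set (prow K l r) :=
  [set u | forall m (t : 'X_{1..l}), (forall j : 'I_l, (j < k)%N -> t j = 0%N) -> (u 0 m)@_t = 0].

Definition row_divx (i : 'I_l) u : prow K l r := \row_m mdivx i (u 0 m).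

Lemma row_xmul_coeff (i : 'I_l) u m t :
  (row_xmul i u 0 m)@_t = if t i == 0%N then 0 else (u 0 m)@_(t - U_(i)).
Proof. by rewrite mxE /xmul xvarE mcoeff_Xmul. Qed.

Lemma subspace_row_ideal k : subspace (row_ideal k).
Proof.
split=> [m t _|c u v hu hv m t ht]; first by rewrite mxE mcoeff0.
by rewrite prowE mcoeffD mcoeffZ hu // hv // mulr0 addr0.
Qed.

(** The variables form a regular sequence on a free module. *)
Lemma row_koszul_exact :
  [/\ forall p (u : kos row_gmod l), hdeg p.+1 u -> kdiff (gx row_gmod) u = 0 ->
        exists2 w : kos row_gmod l, hdeg p.+2 w & u = kdiff (gx row_gmod) w,
      forall u : kos row_gmod l, row_ideal l (kproj (kdiff (gx row_gmod) u)) &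
      forall u : kos row_gmod l, hdeg 0 u -> row_ideal l (kproj u) ->
        exists2 w : kos row_gmod l, hdeg 1 w & u = kdiff (gx row_gmod) w].
Proof.
apply: koszul_exact.
- exact: row_xmulC.
- by move=> v hv; apply/rowP => m; apply/mpolyP => t; rewrite mxE mcoeff0; apply: hv.
- move=> k v lt_kl hv; pose i := Ordinal lt_kl.
  exists (row_divx i v) => m t ht; rewrite mxE mxE mcoeffB.
  rewrite (row_xmul_coeff i) mxE mcoeff_mdivx.
  case: eqP => [ti0|/eqP nz]; last by rewrite submK ?subrr // lep1mP.
  rewrite subr0; apply: hv => j; rewrite ltnS leq_eqVlt => /orP[/eqP jk|/ht //].
  by rewrite -ti0; congr (t _); apply: val_inj.
- by move=> k v _ hv m t ht; apply: hv => j /leqW /ht.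
- move=> k v lt_kl m t ht; rewrite (row_xmul_coeff (Ordinal lt_kl)) ifT //.
  by apply/eqP; apply: ht => /=.
- by move=> k _; apply: subspace_row_ideal.
- move=> k v lt_kl hv m t ht; pose i := Ordinal lt_kl.
  have := hv m (t + U_(i))%MM; rewrite (row_xmul_coeff i) mnmDE mnm1E eqxx addn1 /=.
  rewrite addmK; apply=> j lt_jk; rewrite mnmDE mnm1E ht //.
  by case: eqP => // ij; move: lt_jk; rewrite -ij /= ltnn.
Qed.

Lemma row_fib_eq0 u : row_fib u = 0 <-> row_ideal l u.
Proof.
split=> [/rowP hu m t ht|hu].
  have -> : t = 0%MM by apply/mnmP => j; rewrite mnm0E ht.
  by have := hu m; rewrite !mxE.
by apply/rowP => m; rewrite !mxE hu // => j _; rewrite mnm0E.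
Qed.

(** The row of constant polynomials v. *)
Definition row_lft (v : 'rV[K]_r) : prow K l r := \row_m (v 0 m)%:MP.

(** The degree k part of the fibre, which inherits the degrees of the basis. *)
Definition fib_deg_row (k : nat) : set 'rV[K]_r :=
  [set v | forall m, v 0 m != 0 -> a m = k].

Lemma row_lftK (v : 'rV[K]_r) : row_fib (row_lft v) = v.
Proof. by apply/rowP => m; rewrite !mxE mcoeffC eqxx mulr1. Qed.

Lemma row_fib_deg e u : row_deg e u -> fib_deg_row e (row_fib u).
Proof.
move=> hu m; rewrite mxE -mcoeff_msupp => /(hu m).
by rewrite mdeg0 addn0.
Qed.

Lemma row_lft_deg e (v : 'rV[K]_r) : fib_deg_row e v -> row_deg e (row_lft v).
Proof.
move=> hv m t; rewrite mxE mcoeff_msupp mcoeffC.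
have [->|_] := eqVneq t 0%MM; last by rewrite mulr0 eqxx.
by rewrite mulr1 mdeg0 addn0; apply: hv.
Qed.

Definition row_acyclic : acyclic l row_gmod 'rV[K]_r :=
  @Acyclic K l row_gmod 'rV[K]_r row_fib row_lft fib_deg_row
    row_lftK row_fib_deg row_lft_deg
    (let: And3 ex _ _ := row_koszul_exact in ex)
    (let: And3 _ img _ := row_koszul_exact in
       fun (u : kos row_gmod l) => (row_fib_eq0 _).2 (img u))
    (let: And3 _ _ ex0 := row_koszul_exact in
       fun (u : kos row_gmod l) hu fu0 => ex0 u hu ((row_fib_eq0 _).1 fu0)).

End Scale.

Section Matrix.
Variables (r s : nat) (D : 'M[{mpoly K[l]}]_(r, s)).

(** The map of free modules with matrix D. *)
Definition row_mul (u : prow K l r) : prow K l s := u *m D.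

Lemma row_mul_is_linear : linear row_mul.
Proof. by move=> c u v; rewrite /row_mul mulmxDl -scalemxAl. Qed.

HB.instance Definition _ :=
  GRing.isLinear.Build K (prow K l r) (prow K l s) _ row_mul row_mul_is_linear.

Lemma row_mul_xmul j u : row_mul (row_xmul j u) = row_xmul j (row_mul u).
Proof.
have xE r' (v : prow K l r') : row_xmul j v = xvar K l j *: (v : 'rV_r').
  by apply/rowP => m; rewrite !mxE.
by rewrite !xE /row_mul -scalemxAl.
Qed.

Lemma row_fib_mul u : row_fib (row_mul u) = row_fib u *m map_mx (mcoeff 0%MM) D.
Proof. exact: map_mxM. Qed.

End Matrix.
End FreeModules.

(** * Betti numbers as Koszul homology *)

Section BettiKoszul.
Variables (K : fieldType) (l : nat).

Lemma dhomog_shomog e (p : {mpoly K[l]}) : p \is e.-homog <-> shomog 0 e p.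
Proof. by split=> [/dhomogP|] h; [|apply/dhomogP] => t /h. Qed.

(** The augmentation of a resolution, from the first free module to S. *)
Definition row_aug r (D : 'M[{mpoly K[l]}]_(r, 1)) (u : prow K l r) : {mpoly K[l]} :=
  row_mul D u 0 0.

Lemma row_aug_is_linear r (D : 'M[{mpoly K[l]}]_(r, 1)) : linear (row_aug D).
Proof. by move=> c u v; rewrite /row_aug linearP /= prowE. Qed.

HB.instance Definition _ r (D : 'M[{mpoly K[l]}]_(r, 1)) :=
  GRing.isLinear.Build K (prow K l r) {mpoly K[l]} _ (row_aug D)
    (row_aug_is_linear D).

(** Homogeneous ideals of the polynomial ring. *)
Definition homog_ideal (I : set {mpoly K[l]}) : Prop :=
  [/\ subspace I, forall e p, I p -> I (hcomp 0 e p) & forall j p, I p -> I (xmul j p)].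

Variable I : set {mpoly K[l]}.
Hypothesis hI : homog_ideal I.

(** The dimension of the Koszul homology of S / I in homological degree i and
    internal degree i + j. *)
Definition koszul_qdim i j :=
  has_qdim (@kcyc K l (poly_gmod K l) I i j) (@kbnd K l (poly_gmod K l) I i).

(** The dimension of Tor, computed with any resolution of S / I, is that of the
    Koszul homology of S / I. *)
Lemma betti_koszul (F : graded_free_resolution I) i j d :
  koszul_qdim i j d <->
  has_qdim [set v | @tor_degree _ _ _ F i (i + j) v /\ tor_cycle v]
           (@tor_boundary _ _ _ F i) d.
Proof.
case: F => rk sh D aug h1 h2 h3 h4 h5; case: hI => sI pI xI.
pose A i := row_gmod K l (@sh i).
pose f i : {linear A i.+1 -> A i} := row_mul (D i).
pose T i : {linear 'rV[K]_(rk i.+1) -> 'rV[K]_(rk i)} :=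
  mulmxr (map_mx (mcoeff 0%MM) (D i)).
have gf k : graded_map (f k).
  by split=> [a v|e v]; [apply: row_mul_xmul | apply: h1].
have fT k b : fib (@row_acyclic K l _ (@sh k)) (f k b) =
    T k (fib (@row_acyclic K l _ (@sh k.+1)) b).
  exact: row_fib_mul.
have exf k v : f k v = 0 <-> exists w, v = f k.+1 w by apply: h5.
have ga : graded_map (A := A 0%N) (B := poly_gmod K l) (row_aug aug).
  split=> [k v|e v hv] /=; first by rewrite /row_aug row_mul_xmul mxE.
  by apply/dhomog_shomog; apply: h2.
rewrite /koszul_qdim -(@koszul_iso K l (A 0%N) (poly_gmod K l) (row_aug aug) ga
  [set a | exists b, a = f 0%N b] I i j d) //.
- case: i => [|i].
    by rewrite (koszul_tor0 fT); apply: eq_has_qdim.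
  rewrite (koszul_tor_shift gf fT exf i 0 j d) add0n addnC.
  exact: eq_has_qdim.
- by move=> a; split=> [[w ->]|/h4 //]; apply/h4; exists w.
Qed.

End BettiKoszul.

(** * Monomial ideals *)

Section Monomial.
Variables (K : fieldType) (l : nat).

(** A monomial ideal, described by the monomials that it contains. *)
Definition mono_ideal (I : set {mpoly K[l]}) : Prop :=
  (forall p, I p <-> forall t, p@_t != 0 -> I 'X_[t]) /\
  (forall t u, I 'X_[t] -> I 'X_[t + u]).

Lemma monomial_ideal_mono (I : set {mpoly K[l]}) : monomial_ideal I -> mono_ideal I.
Proof.
move=> [A hA].
have supp p : I p -> forall t, p@_t != 0 -> exists2 a, A a & (a <= t)%MM.
  move=> /hA [s [As ->]] t; rewrite raddf_sum /= => nz.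
  have [u us uc] : exists2 u, u \in s & (u.2 * 'X_[u.1])@_t != 0.
    apply: contrapT => h; case/eqP: nz; rewrite big_seq big1 // => u us.
    by apply/eqP; apply: contrapT => /negP nz; apply: h; exists u.
  exists u.1; first exact: As.
  move: uc; rewrite -mcoeff_msupp (perm_mem (msuppMX _ _)) => /mapP[v _ ->].
  exact: lem_addr.
have span p : (forall t, p@_t != 0 -> exists2 a, A a & (a <= t)%MM) -> I p.
  move=> h.
  have /choice[a ha] : forall t, exists a, p@_t != 0 -> A a /\ (a <= t)%MM.
    move=> t; have [_|nz] := eqVneq p@_t 0; first by exists 0%MM.
    by have [a Aa le_at] := h _ nz; exists a.
  apply/hA; exists [seq (a t, p@_t *: 'X_[t - a t]) | t <- msupp p]; split.
    move=> u /mapP[t tp ->] /=; have [|//] := ha t.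
    by rewrite -mcoeff_msupp.
  rewrite big_map [LHS]mpolyE big_seq [RHS]big_seq; apply: eq_bigr => t tp /=.
  by rewrite -scalerAl -mpolyXD submK //; case: (ha t); rewrite -?mcoeff_msupp.
have monoE t : I 'X_[t] <-> exists2 a, A a & (a <= t)%MM.
  split=> [/supp|h].
    by move=> /(_ t); rewrite mcoeffX eqxx oner_eq0; apply.
  by apply: span => u; rewrite mcoeffX; case: (t =P u) => [<-|_]; rewrite ?eqxx.
split=> [p|t u /monoE[a Aa le_at]].
  split=> [/supp h t nz|h]; first by apply/monoE/h.
  by apply: span => t /h /monoE.
apply/monoE; exists a => //; apply: lepm_trans le_at _; exact: lem_addr.
Qed.

Variable I : set {mpoly K[l]}.
Hypothesis mI : mono_ideal I.

Lemma mono_sub (p q : {mpoly K[l]}) :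
  (forall t, p@_t != 0 -> q@_t != 0) -> I q -> I p.
Proof. by move=> pq /mI.1 hq; apply/mI.1 => t /pq /hq. Qed.

Lemma subspace_mono : subspace I.
Proof.
split=> [|c p q /mI.1 hp /mI.1 hq].
  by apply/mI.1 => t; rewrite mcoeff0 eqxx.
apply/mI.1 => t; rewrite mcoeffD mcoeffZ.
have [->|nz] := eqVneq p@_t 0; last by move=> _; apply: hp.
by rewrite mulr0 add0r; apply: hq.
Qed.

Lemma mono_xmul j p : I p -> I (xmul j p).
Proof.
move=> /mI.1 hp; apply/mI.1 => t; rewrite /xmul.
have [lt_jl|le_lj] := ltnP j l; last by rewrite xvar0 // mul0r mcoeff0 eqxx.
rewrite (xvarE K (Ordinal lt_jl)) mcoeff_Xmul; case: (t _ =P 0%N); first by rewrite eqxx.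
move=> /eqP nz /hp h; rewrite -(submK (m := U_(Ordinal lt_jl)) (m' := t)) ?lep1mP //.
exact: mI.2.
Qed.

Lemma mono_homog_ideal : homog_ideal I.
Proof.
split; [exact: subspace_mono | | exact: mono_xmul].
move=> e p; apply: mono_sub => t; rewrite mcoeff_hcomp.
by case: ifP; rewrite ?eqxx.
Qed.

End Monomial.

(** * The last variable *)

Section Widen.
Variables (K : fieldType) (n : nat).

HB.instance Definition _ :=
  GRing.isScalable.Build K {mpoly K[n]} {mpoly K[n.+1]} _ (@mwiden n K)
    (@mwidenZ n K).

(** The part of p without the last variable. *)
Definition narrow (p : {mpoly K[n.+1]}) : {mpoly K[n]} := mpull (@mnmwiden n) p.

(** The monomial t with its last exponent dropped. *)
Definition mrestr (t : 'X_{1..n.+1}) : 'X_{1..n} :=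
  [multinom t (widen_ord (leqnSn n) i) | i < n].

Lemma mnmwiden_restr (t : 'X_{1..n.+1}) :
  t ord_max = 0%N -> mnmwiden (mrestr t) = t.
Proof.
move=> t0; apply/mnmP => i; have [j ->|->] := unliftP ord_max i; last first.
  by rewrite mnmwiden_ordmax t0.
have -> : lift ord_max j = widen_ord (leqnSn n) j.
  by apply: val_inj; rewrite /= /bump leqNgt ltn_ord.
by rewrite mnmwiden_widen mnmE.
Qed.

Lemma mdeg_mnmwiden (t : 'X_{1..n}) : mdeg (mnmwiden t) = mdeg t.
Proof.
rewrite !mdegE big_ord_recr /= mnmwiden_ordmax addn0.
by apply: eq_bigr => i _; rewrite mnmwiden_widen.
Qed.

Lemma mcoeff_narrow p t : (narrow p)@_t = p@_(mnmwiden t).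
Proof. by rewrite mcoeff_mpull // => u; rewrite mdeg_mnmwiden. Qed.

Lemma mcoeff_mwiden (p : {mpoly K[n]}) t :
  (mwiden p)@_t = if t ord_max == 0%N then p@_(mrestr t) else 0.
Proof.
case: eqP => [t0|nz]; first by rewrite -{1}(mnmwiden_restr t0) mwiden_mnmwiden.
rewrite (mwidenE (leqnn _)) raddf_sum big1 // => u _ /=.
rewrite mcoeffZ mcoeffX; case: eqP => [ut|]; last by rewrite mulr0.
by case: nz; rewrite -ut mnmwiden_ordmax.
Qed.

Lemma narrow_is_linear : linear narrow.
Proof.
move=> c p q; apply/mpolyP => t.
by rewrite mcoeffD mcoeffZ !mcoeff_narrow mcoeffD mcoeffZ.
Qed.

HB.instance Definition _ :=
  GRing.isLinear.Build K {mpoly K[n.+1]} {mpoly K[n]} _ narrow narrow_is_linear.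

Lemma mdivx_is_linear l (i : 'I_l) : linear (@mdivx K l i).
Proof.
move=> c p q; apply/mpolyP => t.
by rewrite mcoeffD mcoeffZ !mcoeff_mdivx mcoeffD mcoeffZ.
Qed.

HB.instance Definition _ l (i : 'I_l) :=
  GRing.isLinear.Build K {mpoly K[l]} {mpoly K[l]} _ (@mdivx K l i) (mdivx_is_linear i).

Lemma xmul_last (p : {mpoly K[n.+1]}) t :
  (xmul n p)@_t = if t ord_max == 0%N then 0 else p@_(t - U_(ord_max)).
Proof. by rewrite /xmul (xvarE K (ord_max : 'I_n.+1)) mcoeff_Xmul. Qed.

Lemma mpoly_last_split (p : {mpoly K[n.+1]}) :
  p = mwiden (narrow p) + xmul n (mdivx ord_max p).
Proof.
apply/mpolyP => t; rewrite mcoeffD mcoeff_mwiden xmul_last mcoeff_narrow.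
case: eqP => [t0|/eqP nz]; first by rewrite mnmwiden_restr // addr0.
by rewrite add0r mcoeff_mdivx submK // lep1mP.
Qed.

Lemma mwiden_xmul j (p : {mpoly K[n]}) :
  (j < n)%N -> mwiden (xmul j p) = xmul j (mwiden p).
Proof.
move=> lt_jn; rewrite /xmul mwidenM; congr (_ * _).
rewrite (xvarE K (Ordinal lt_jn)) mwidenX mnmwiden1.
rewrite -[j]/(val (Ordinal (leqW lt_jn : j < n.+1)%N)) xvarE.
by congr 'X_[U_(_)]; apply: val_inj.
Qed.

Lemma shomog_mwiden e (p : {mpoly K[n]}) : shomog 0 e p -> shomog 0 e (mwiden p).
Proof.
move=> /shomogP hp; apply/shomogP => t ne; rewrite mcoeff_mwiden.
case: eqP => // t0; apply: hp.
by rewrite -mdeg_mnmwiden mnmwiden_restr.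
Qed.

Lemma shomog_narrow e (p : {mpoly K[n.+1]}) : shomog 0 e p -> shomog 0 e (narrow p).
Proof.
move=> /shomogP hp; apply/shomogP => t ne; rewrite mcoeff_narrow; apply: hp.
by rewrite mdeg_mnmwiden.
Qed.

Lemma shomog_xmul_mdivx e j (i : 'I_n.+1) (p : {mpoly K[n.+1]}) :
  shomog 0 e p -> shomog 0 e (xmul j (mdivx i p)).
Proof.
move=> /shomogP hp; apply/shomogP => t ne; rewrite /xmul.
have [lt_jl|le_lj] := ltnP j n.+1; last by rewrite xvar0 // mul0r mcoeff0.
rewrite (xvarE K (Ordinal lt_jl)) mcoeff_Xmul; case: eqP => // /eqP nz.
rewrite mcoeff_mdivx; apply: hp; rewrite mdegD mdeg1.
rewrite -(submK (m := U_(Ordinal lt_jl)) (m' := t)) ?lep1mP // in ne.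
by move: ne; rewrite mdegD mdeg1.
Qed.

Lemma contraction_mono (I : set {mpoly K[n.+1]}) :
  mono_ideal I -> mono_ideal (contraction I).
Proof.
move=> [h1 h2]; split=> [p|t u]; rewrite /contraction /=; last first.
  by rewrite !mwidenX mnmwidenD; apply: h2.
split=> [/h1 h t nz|h]; first by rewrite mwidenX; apply: h; rewrite mwiden_mnmwiden.
apply/h1 => t; rewrite mcoeff_mwiden; case: (t _ =P 0%N) => [t0|]; last by rewrite eqxx.
by move=> /h; rewrite /= mwidenX mnmwiden_restr.
Qed.

(** The two summands have disjoint supports. *)
Lemma mono_split (I : set {mpoly K[n.+1]}) (q : {mpoly K[n]}) (r : {mpoly K[n.+1]}) :
  mono_ideal I -> I (mwiden q + xmul n r) -> I (mwiden q) /\ I (xmul n r).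
Proof.
move=> mI h; split; apply: mono_sub h => // t; rewrite mcoeffD mcoeff_mwiden xmul_last.
  by case: ifP; rewrite ?eqxx // addr0.
by case: ifP; rewrite ?eqxx // add0r.
Qed.

End Widen.

(** * Separating the last variable in Koszul homology *)

Section KosDimension.
Variables (K : fieldType) (M : lmodType K) (n : nat).

(** Homological degree p - 1, with no nonzero element when p = 0. *)
Definition hdeg_pred p : set (kos M n) :=
  [set u | if p is p'.+1 then hdeg p' u else u = 0].

Lemma subspace_hdeg_pred p : subspace (hdeg_pred p).
Proof.
case: p => [|p]; last exact: subspace_hdeg.
by split=> // c u v -> ->; rewrite scaler0 addr0.
Qed.

Lemma hdeg_pred_kdiff (x : nat -> {linear M -> M}) p (u : kos M n) :
  hdeg p u -> hdeg_pred p (kdiff x u).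
Proof. by case: p => [|p]; [apply: kdiff_hdeg0 | apply: hdeg_kdiff]. Qed.

End KosDimension.

(** The part of homological degree p of a Koszul module on n generators is a
    sum of 'C(n, p) copies of the module. *)
Lemma kos_qdim (K : fieldType) (M : lmodType K) (P W : set M) n p d :
    subspace P -> subspace W -> has_qdim P W d ->
  has_qdim [set u : kos M n | hdeg p u /\ kall P u] (kall W (n:=n)) ('C(n, p) * d).
Proof.
move=> sP sW hd; elim: n p => [|n IH] p.
  case: p => [|p]; rewrite ?bin0 ?mul1n ?bin0n ?mul0n /=.
    apply/(eq_has_qdim (U := P) (W := W)); last exact: hd; last by [].
    by move=> v; split=> [Pv|[]//]; split=> //; left.
  by apply: has_qdim0 => v [[//|->] _]; apply: subspace0.
have sU q m : subspace [set u : kos M m | hdeg q u /\ kall P u].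
  by apply: subspaceI; [apply: subspace_hdeg | apply: subspace_kall].
have sUp : subspace [set u : kos M n | hdeg_pred p u /\ kall P u].
  by apply: subspaceI; [apply: subspace_hdeg_pred | apply: subspace_kall].
have hpred : has_qdim [set u : kos M n | hdeg_pred p u /\ kall P u] (kall W (n:=n))
    ((if p is p'.+1 then 'C(n, p') else 0) * d).
  case: p {sUp} => [|p]; last exact: IH.
  by rewrite mul0n; apply: has_qdim0 => v [-> _]; apply: subspace0; apply: subspace_kall.
have -> : 'C(n.+1, p) = ('C(n, p) + (if p is p'.+1 then 'C(n, p') else 0))%N.
  by case: p {hpred sUp} => [|p]; rewrite ?bin0 // binS.
rewrite mulnDl.
have := has_qdim_prod (IH p) hpred (sU p n) (subspace_kall n sW) sUp (subspace_kall n sW).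
apply: (eq_has_qdim _ _ _).1 => [u|//] /=.
by split=> [[[h1 h2] [h3 h4]]|[[h1 h3] [h2 h4]]].
Qed.

Section LastVariable.
Variables (K : fieldType) (n : nat) (I : set {mpoly K[n.+1]}).
Hypothesis mI : mono_ideal I.

(** The annihilator of the last variable modulo I. *)
Definition ann_last : set {mpoly K[n.+1]} := [set p | I (xmul n p)].

Hypothesis ann_socle : forall j p, ann_last p -> I (xmul j p).

Local Notation S := (poly_gmod K n.+1).
Local Notation S' := (poly_gmod K n).
Local Notation d := (kdiff (gx S)).
Local Notation d' := (kdiff (gx S')).
Local Notation wid := (@mwiden n K).
Local Notation x_ := (@xmul K n.+1 n).

Lemma kmap_wid_kdiff (c : kos S' n) : kmap wid (d' c) = d (kmap wid c).
Proof. by apply: kmap_kdiff => j v lt_jn; apply: mwiden_xmul. Qed.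

Lemma kall_split (c : kos S' n) (b : kos S n) :
  kall I (kmap wid c + kmap x_ b : kos S n) ->
  kall (contraction I) c /\ kall ann_last b.
Proof.
suff h m (c1 : kos S' m) (b1 : kos S m) :
    kall I (kmap wid c1 + kmap x_ b1 : kos S m) ->
    kall (contraction I) c1 /\ kall ann_last b1 by apply: h.
elim: m c1 b1 => [|m IH] c1 b1 /=; first exact: mono_split.
by case=> /IH[? ?] /IH[? ?].
Qed.

Lemma kos_last_split (a : kos S n) :
  a = kmap wid (kmap (@narrow K n) a) + kmap x_ (kmap (mdivx ord_max) a).
Proof.
suff h m (a1 : kos S m) :
   a1 = kmap wid (kmap (@narrow K n) a1) + kmap x_ (kmap (mdivx ord_max) a1) by apply: h.
elim: m a1 => [|m IH] a1 /=; first exact: mpoly_last_split.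
by case: a1 => a1 b1 /=; congr (_, _); apply: IH.
Qed.

Lemma kall_ann_kdiff (b : kos S n) : kall ann_last b -> kall I (d b).
Proof.
apply: kall_kdiff; first exact: subspace_mono.
by move=> j v _; apply: ann_socle.
Qed.

Lemma subspace_ann : subspace ann_last.
Proof. exact: (subspace_preim (@xmul K n.+1 n) (subspace_mono mI)). Qed.

(** The map (c, b) |-> c + b e, where e is the last exterior generator. It induces
    the isomorphism of [koszul_last]. *)
Let iota (v : kos S' n * kos S n) : kos S n.+1 := (kmap wid v.1, v.2).

Let iota_linear a u v : iota (a *: u + v) = a *: iota u + iota v.
Proof. by rewrite /iota /= linearP. Qed.

Let d_iota c b : d (iota (c, b)) = (kmap wid (d' c) + kmap x_ b, - d b).
Proof. by rewrite /= kmap_wid_kdiff. Qed.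

(** The inclusion of K[x_1, ..., x_n] in K[x_1, ..., x_(n+1)] splits the long exact
    sequence that relates the Koszul homology of S / I on n + 1 variables to that
    on n variables of the kernel and cokernel of multiplication by x_(n+1). *)
Lemma koszul_last i j d1 d2 :
    koszul_qdim (contraction I) i j d1 ->
    has_qdim [set p | shomog 0 j p /\ ann_last p] I d2 ->
  koszul_qdim I i j (d1 + (if i is i'.+1 then 'C(n, i') else 0) * d2).
Proof.
move=> hd1 hd2.
have sI := subspace_mono mI; have sI' := subspace_mono (contraction_mono mI).
have sV := subspace_ann.
pose P : set {mpoly K[n.+1]} := [set p | shomog 0 j p /\ ann_last p]%classic.
have sP : subspace P by apply: subspaceI => //; apply: subspace_shomog.
pose U2 : set (kos S n) := [set b | hdeg_pred i b /\ kall P b]%classic.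
have sU2 : subspace U2.
  by apply: subspaceI; [apply: subspace_hdeg_pred | apply: subspace_kall].
have hU2 : has_qdim U2 (kall I (n:=n)) ((if i is i'.+1 then 'C(n, i') else 0) * d2).
  rewrite /U2; case: (i) => [|i']; last exact: kos_qdim.
  by rewrite mul0n; apply: has_qdim0 => v [-> _]; apply: subspace0; apply: subspace_kall.
have sU1 := @subspace_kcyc K n S' (contraction I) i j sI'.
have sW1 := @subspace_kbnd K n S' (contraction I) i sI'.
have sIn m := subspace_kall m sI.
have hprod := has_qdim_prod hd1 hU2 sU1 sW1 sU2 (sIn n).
pose R (u : kos S n.+1) (v : (kos S' n * kos S n)%type) : Prop :=
  exists2 w : kos S n.+1, hdeg i.+1 w & kall I (u - iota v - d w).
apply: (proj2 (has_qdim_corr_iff (R := R) _ _ _ _ _ _ _ _)) hprod.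
- exact: subspace_kcyc.
- apply: subspaceI.
    exact: (subspace_preim fst sU1).
  exact: (subspace_preim snd sU2).
- exists 0; first exact: subspace0 (subspace_hdeg _ _ _).
  have -> : iota 0 = 0 by rewrite /iota linear0.
  by rewrite subr0 add0r !linear0; apply: subspace0; apply: sIn.
- move=> a u1 u2 v1 v2 [w1 h1 I1] [w2 h2 I2]; exists (a *: w1 + w2).
    exact: (subspace_hdeg _ _ _).2.
  have -> : a *: u1 + u2 - iota (a *: v1 + v2) - d (a *: w1 + w2) =
      a *: (u1 - iota v1 - d w1) + (u2 - iota v2 - d w2).
    rewrite iota_linear (kdiff_is_linear (gx S)) !scalerBr !opprD.
    by rewrite (addrACA (a *: u1)); apply: addrACA.
  exact: (sIn _).2.
- move=> [a b] [/= [ha hb] [da db] [Ia Ib]].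
  (* Subtracting the boundary of a1 e removes the last variable from a. *)
  pose a1 := kmap (mdivx ord_max) a; pose c := kmap (@narrow K n) a.
  have ea : a = kmap wid c + kmap x_ a1 := kos_last_split a.
  have ha1 : hdeg i a1 by apply: hdeg_kmap.
  have da1 : kall (shomog 0 j) (d a1).
    apply: (kall_kdiff (P := [set p | forall k, shomog 0 j (xmul k p)])) => //.
      exact: subspace_shomog.
      by move=> k v _; apply.
    by apply: kall_kmap da => v hv k; apply: shomog_xmul_mdivx.
  have eab : ((a, b) : kos S n.+1) - d ((0, a1) : kos S n.+1) = iota (c, b + d a1).
    rewrite /iota /= linear0 add0r; congr (_, _); last by rewrite /= opprK.
    by rewrite /= {1}ea addrK.
  have dab : d (iota (c, b + d a1)) = d ((a, b) : kos S n.+1).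
    by rewrite -eab kdiff_sub_bnd.
  have [Ic Vb] : kall (contraction I) (d' c) /\ kall ann_last (b + d a1).
    by apply: kall_split; move: dab; rewrite d_iota => -[-> _].
  exists (c, b + d a1).
    split; split.
    + exact: hdeg_kmap.
    + by apply: kall_kmap da => v; apply: shomog_narrow.
    + exact: Ic.
    + apply: subspaceD; [exact: subspace_hdeg_pred | exact: hb | exact: hdeg_pred_kdiff].
    + apply: kall_and => //; apply: subspaceD => //.
      by apply: subspace_kall; apply: subspace_shomog.
  exists (0, a1); first by split=> //; apply: subspace0; apply: subspace_hdeg.
  rewrite -eab subKr subrr.
  by apply: subspace0; apply: sIn.
- move=> [c b] [/= [hc dc Ic] [hb Pb]]; exists (iota (c, b)).
    split.
    + by split; [apply: hdeg_kmap | exact: hb].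
    + split; first by apply: kall_kmap dc => v; apply: shomog_mwiden.
      by apply: kall_sub Pb => v [].
    + rewrite d_iota; split.
        apply: subspaceD => //; first by apply: kall_kmap Ic.
        by apply: kall_kmap Pb => v [].
      apply: subspaceN => //; apply: kall_ann_kdiff.
      by apply: kall_sub Pb => v [].
  exists 0; first exact: subspace0 (subspace_hdeg _ _ _).
  by rewrite subrr linear0 subr0; apply: subspace0; apply: sIn.
- move=> u [c b] _ _ [w hw Iw].
  (* Modulo the boundary d w, it can be assumed that u = iota (c, b). *)
  have -> : @kbnd K n.+1 S I i u <-> @kbnd K n.+1 S I i (iota (c, b)).
    apply: subspace_congr; first exact: subspace_kbnd.
    by exists w.
  split=> [[[p q] [/= hp hq] []]|[[p hp Ip] Ib]].
    rewrite /= => I1 I2.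
    pose p0 := kmap (@narrow K n) p; pose p1 := kmap (mdivx ord_max) p.
    have ep : p = kmap wid p0 + kmap x_ p1 := kos_last_split p.
    have [|I3 V4] := @kall_split (c - d' p0) (- (d p1 + q)).
      have dp : d p = kmap wid (d' p0) + kmap x_ (d p1).
        rewrite {1}ep linearD /= kmap_wid_kdiff kdiff_kmapx // => k k' v.
        exact: xmulC.
      move: I1; rewrite dp; congr (kall I _); rewrite linearB linearN /= [kmap _ (_ + q)]linearD /=.
      by rewrite !opprD !addrA.
    split; first by exists p0 => //; apply: hdeg_kmap.
    have /= dd0 := @kdiffK_gx K n S p1.
    have := kall_ann_kdiff V4; rewrite linearN /= [kdiff _ (_ + q)]linearD /= dd0 add0r => I5.
    by rewrite opprK in I2; rewrite -(addrK (d q) b); apply: subspaceD.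
  exists (kmap wid p, 0).
    split; first exact: hdeg_kmap.
    by apply: subspace0; apply: subspace_hdeg.
  rewrite /= -kmap_wid_kdiff !linear0 addr0; split=> /=.
    by rewrite -linearB; apply: kall_kmap Ip.
  by rewrite addr0.
Qed.

End LastVariable.

(** * Strongly stable ideals and the weak Lefschetz property *)

Section StronglyStable.
Variables (K : fieldType) (n : nat) (I : set {mpoly K[n.+1]}).
Hypothesis mI : mono_ideal I.
Hypothesis stabI : forall (t : 'X_{1..n.+1}) (i j : 'I_n.+1),
  I 'X_[t] -> (i < j)%N -> (0 < t j)%N -> I 'X_[(t - U_(j)) + U_(i)].

Let sI : subspace I := subspace_mono mI.

Lemma stable_swap (t : 'X_{1..n.+1}) (i j : 'I_n.+1) :
  (i <= j)%N -> I 'X_[t + U_(j)] -> I 'X_[t + U_(i)].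
Proof.
rewrite leq_eqVlt => /orP[/eqP /val_inj -> //|lt_ij] h.
have := stabI h lt_ij; rewrite addmK; apply.
by rewrite mnmDE mnm1E eqxx addn1.
Qed.

(** The annihilator of the last variable modulo I lies in the socle. *)
Lemma stable_socle j p : ann_last I p -> I (xmul j p).
Proof.
move=> /mI.1 hp; apply/mI.1 => t; rewrite /xmul.
have [lt_jl|le_lj] := ltnP j n.+1; last by rewrite xvar0 // mul0r mcoeff0 eqxx.
pose i := Ordinal lt_jl; rewrite (xvarE K i) mcoeff_Xmul.
case: (t i =P 0%N) => [_|/eqP nz h]; first by rewrite eqxx.
rewrite -(submK (m := U_(i)) (m' := t)) ?lep1mP //.
apply: (@stable_swap _ i ord_max); first by rewrite -ltnS.
by apply: hp; rewrite xmul_last mnmDE mnm1E eqxx addn1 /= addmK.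
Qed.

Lemma linear_form (q : {mpoly K[n.+1]}) :
  q \is 1.-homog -> q = \sum_i q@_U_(i) *: 'X_i.
Proof.
move=> /dhomog_shomog /shomogP hq; apply/mpolyP => t; rewrite raddf_sum /=.
have [/eqP|nt] := eqVneq (mdeg t) 1%N; last first.
  rewrite hq // big1 // => i _; rewrite mcoeffZ mcoeffX.
  by case: eqP => [ti|]; rewrite ?mulr0 //; rewrite -ti mdeg1 eqxx in nt.
move/mdeg1P => [k /eqP ->]; rewrite (bigD1 k) //= big1 ?addr0 => [|i ne].
  by rewrite mcoeffZ mcoeffX eqxx mulr1.
by rewrite mcoeffZ mcoeffX eq_mnm1 (negbTE ne) mulr0.
Qed.

Lemma ann_last_linear ell p : ell \is 1.-homog -> ann_last I p -> I (ell * p).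
Proof.
move=> /linear_form -> hp; rewrite mulr_suml; apply: subspace_sum => // i _.
rewrite -scalerAl; apply: subspaceZ => //.
by have := stable_socle (val i) hp; rewrite /xmul xvarE.
Qed.

(** If the d-th power of the last variable is in I, then so are all polynomials
    of degree d. *)
Lemma stable_pow_last d (t : 'X_{1..n.+1}) :
  I 'X_[U_(ord_max) *+ d] -> mdeg t = d -> I 'X_[t].
Proof.
suff h e f (u : 'X_{1..n.+1}) : mdeg u = e ->
    I 'X_[U_(ord_max) *+ (e + f)] -> I 'X_[u + U_(ord_max) *+ f].
  by move=> Id td; have := h d 0%N t td; rewrite addn0 addm0; apply.
elim: e f u => [|e IH] f u ue.
  by have /eqP := ue; rewrite mdeg_eq0 => /eqP ->; rewrite add0m.
have [i ui] : exists i, u i != 0%N.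
  apply: contrapT => /forallNP h; have := ue; rewrite mdegE big1 // => i _.
  by apply/eqP; apply: contrapT => /negP; apply: h.
have uE : (u = u - U_(i) + U_(i))%MM by rewrite submK // lep1mP.
rewrite addSnnS => /(IH f.+1 (u - U_(i))%MM).
have -> : mdeg (u - U_(i)) = e.
  by move: ue; rewrite {1}uE mdegD mdeg1 addn1 => -[].
rewrite mulmSr addmA => /(_ erefl) /(@stable_swap _ i ord_max).
rewrite -ltnS ltn_ord => /(_ isT).
by rewrite -addmA [(_ *+ f + _)%MM]addmC addmA -uE.
Qed.

(** The substitution of L for the variable m. *)
Definition subst_var (m : 'I_n.+1) (L p : {mpoly K[n.+1]}) : {mpoly K[n.+1]} :=
  p \mPo [tuple if i == m then L else 'X_i | i < n.+1].

Lemma subst_varX m L (t : 'X_{1..n.+1}) : t m = 0%N -> subst_var m L 'X_[t] = 'X_[t].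
Proof.
move=> tm; rewrite /subst_var comp_mpolyX mpolyXE_id; apply: eq_bigr => i _.
by rewrite tnth_mktuple; case: eqP => // ->; rewrite tm !expr0.
Qed.

(** A strongly stable ideal is preserved when a variable is replaced by a
    combination of previous ones. *)
Lemma stable_subst m (b : 'I_n.+1 -> K) p :
  I p -> I (subst_var m (\sum_(i < n.+1 | (i < m)%N) b i *: 'X_i) p).
Proof.
set L := \sum_(_ | _) _ => hp.
have pow a s : I 'X_[s + U_(m) *+ a] -> I ('X_[s] * L ^+ a).
  elim: a s => [|a IH] s; first by rewrite addm0 mulr1.
  move=> h; rewrite exprS mulrCA mulr_suml; apply: subspace_sum => // i lt_im.
  rewrite -scalerAl mulrA -mpolyXD; apply: subspaceZ => //; apply: IH.
  rewrite -addmA addmC; apply: (stable_swap (ltnW lt_im)).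
  by rewrite -addmA -mulmSr.
rewrite (mpolyE p) /subst_var linear_sum big_seq; apply: subspace_sum => // t tp.
rewrite linearZ; apply: subspaceZ => //=.
have tE : (t = (t - U_(m) *+ t m) + U_(m) *+ t m)%MM.
  rewrite submK //; apply/mnm_lepP => i; rewrite mulmnE mnm1E.
  by case: eqP => [->|_]; rewrite ?mul1n.
rewrite {1}tE mpolyXD -mpolyXn rmorphM rmorphXn /=.
rewrite -/(subst_var m L _) subst_varX; last first.
  by rewrite mnmBE mulmnE mnm1E eqxx mul1n subnn.
rewrite comp_mpolyXU -tnth_nth tnth_mktuple eqxx.
by apply: pow; rewrite -tE; apply/(mI.1 p).1 => //; rewrite -mcoeff_msupp.
Qed.

(** A linear form that is surjective on S / I from degree j to degree j + 1
    forces the last variable to be so: I contains all monomials of degree j + 1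
    in the other variables. *)
Lemma surj_last ell j :
    ell \is 1.-homog ->
    (forall q : {mpoly K[n.+1]}, q \is j.+1.-homog ->
       exists2 p : {mpoly K[n.+1]}, p \is j.-homog & I (q - ell * p)) ->
  forall q : {mpoly K[n.+1]}, shomog 0 j.+1 q ->
    exists2 p, shomog 0 j p & I (q - xmul n p).
Proof.
move=> hell surj.
suff mon t : mdeg t = j.+1 -> t ord_max = 0%N -> I 'X_[t].
  move=> q hq; exists (mdivx ord_max q).
    move/shomogP: hq => hq; apply/shomogP => t ne; rewrite mcoeff_mdivx; apply: hq.
    by rewrite mdegD mdeg1 addn1 eqSS.
  rewrite {1}(mpoly_last_split q) addrK; apply/mI.1 => t.
  rewrite mcoeff_mwiden; case: (t ord_max =P 0%N) => [t0|]; last by rewrite eqxx.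
  rewrite mcoeff_narrow mnmwiden_restr // => nz; apply: mon => //.
  by apply: hq; rewrite mcoeff_msupp.
move=> td tm.
have elim t' : mdeg t' = j.+1 -> exists p, I ('X_[t'] - ell * p).
  by move=> t'd; have [|p _ hp] := surj 'X_[t']; [rewrite dhomogX; apply/eqP | exists p].
have [/existsP[i0 nz0]|/existsPn all0] := boolP [exists i : 'I_n.+1, ell@_U_(i) != 0];
    last first.
  have ell0 : ell = 0.
    rewrite (linear_form hell) big1 // => i _.
    by have := all0 i; rewrite negbK => /eqP ->; rewrite scale0r.
  by have [p] := elim _ td; rewrite ell0 mul0r subr0.
(* The last variable that occurs in ell is eliminated. *)
have [m nzm maxm] := @arg_maxnP _ i0 (fun i => ell@_U_(i) != 0) val nz0.
pose L := \sum_(i < n.+1 | (i < m)%N) (- (ell@_U_(m))^-1 * ell@_U_(i)) *: 'X_i.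
have ellL : subst_var m L ell = 0.
  rewrite {1}(linear_form hell) /subst_var linear_sum (bigD1 m) //=.
  rewrite linearZ /= comp_mpolyXU -tnth_nth tnth_mktuple eqxx.
  rewrite (bigID (fun i : 'I_n.+1 => (i < m)%N)) /= [X in _ + (_ + X)]big1; last first.
    move=> i /andP[ne]; rewrite -leqNgt => le_mi.
    suff -> : ell@_U_(i) = 0 by rewrite scale0r linear0.
    apply/eqP; apply: contraNT ne => /maxm le_im.
    by apply/eqP/val_inj/eqP; rewrite eqn_leq le_mi andbT.
  rewrite addr0 scaler_sumr.
  rewrite [X in _ + X](eq_bigl (fun i : 'I_n.+1 => (i < m)%N)); last first.
    by move=> i; case: eqP => //= ->; rewrite ltnn.
  rewrite -big_split big1 //= => i lt_im.
  rewrite comp_mpolyZ comp_mpolyXU -tnth_nth tnth_mktuple.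
  have -> : (i == m) = false by apply/eqP => im; rewrite im ltnn in lt_im.
  by rewrite scalerA mulrA mulrN divff // mulN1r scaleNr addNr.
have key t' : mdeg t' = j.+1 -> t' m = 0%N -> I 'X_[t'].
  move=> t'd t'm; have [p hp] := elim _ t'd.
  have := stable_subst m (fun i => - (ell@_U_(m))^-1 * ell@_U_(i)) hp.
  rewrite -/L /subst_var linearB rmorphM /= -!/(subst_var m L _) ellL mul0r subr0.
  by rewrite subst_varX.
have [mmax|nmax] := eqVneq m ord_max; first by apply: key; rewrite // mmax.
apply: (@stable_pow_last j.+1) => //; apply: key; first by rewrite mdegMn mdeg1 mul1n.
by rewrite mulmnE mnm1E eq_sym (negbTE nmax).
Qed.

End StronglyStable.

(** * Hilbert functions and conclusion *)

Section HilbertFunction.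
Variables (K : fieldType) (l : nat) (I : set {mpoly K[l]}).
Hypothesis sI : subspace I.

Lemma homog_qdim_ex (U : set {mpoly K[l]}) j :
  subspace U -> (forall p, U p -> shomog 0 j p) -> exists d, has_qdim U I d.
Proof.
move=> sU Uj; pose Y (i : 'I_#|{: 'X_{1..l < j.+1}}|) : {mpoly K[l]} := 'X_[enum_val i].
apply: (has_qdim_ex (Y := Y)) => // p /Uj hp.
exists (fun i : 'I_#|{: 'X_{1..l < j.+1}}| => p@_(enum_val i : 'X_{1..l < j.+1})).
rewrite -(big_enum_val (fun u : 'X_{1..l < j.+1} => p@_u *: 'X_[u])).
have -> : \sum_(u : 'X_{1..l < j.+1}) p@_u *: 'X_[u] = p.
  apply/mpolyP => t; rewrite (mcoeff_mpoly_trunc (fun u => p@_u)).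
  case: ltnP => // lt_jt; move/shomogP: hp => -> //.
  by rewrite add0n neq_ltn lt_jt orbT.
by rewrite subrr; apply: subspace0.
Qed.

Lemma hilbert_funP j : has_qdim (shomog 0 j) I (hilbert_fun I j).
Proof.
have [d hd] := homog_qdim_ex (subspace_shomog K l 0 j) (fun=> id).
suff -> : hilbert_fun I j = d by [].
rewrite /hilbert_fun (_ : [set p | _]%classic = shomog 0 j); first exact: qdimE hd.
by apply/predeqP => p; apply: dhomog_shomog.
Qed.

(** If multiplication by f is injective or surjective from (S / I)_j to
    (S / I)_(j+1), the dimension of its kernel is the drop of the Hilbert
    function. *)
Lemma kernel_qdim (f : {linear {mpoly K[l]} -> {mpoly K[l]}}) j :
    (forall p, I p -> I (f p)) ->
    (forall p, shomog 0 j p -> shomog 0 j.+1 (f p)) ->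
    (forall p, shomog 0 j p -> I (f p) -> I p) \/
    (forall q, shomog 0 j.+1 q -> exists2 p, shomog 0 j p & I (q - f p)) ->
  has_qdim [set p | shomog 0 j p /\ I (f p)] I (hilbert_drop I j.+1).
Proof.
move=> fI fdeg; rewrite /hilbert_drop.
have [X [dX iX sX]] := hilbert_funP j.
have [Y [dY iY sY]] := hilbert_funP j.+1.
case=> [inj|surj].
  suff -> : (hilbert_fun I j - hilbert_fun I j.+1)%N = 0%N.
    by apply: has_qdim0 => p []; apply: inj.
  apply/eqP; rewrite subn_eq0.
  apply: (indep_le_span (X := fun i => f (X i)) (Y := Y) sI) => [c Ic|i].
    apply: (iX c); apply: inj; first last.
      by rewrite linear_sum; under eq_bigr do rewrite linearZ.
    exact: (subspace_comb (subspace_shomog K l 0 j)).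
  by apply: sY; apply: fdeg.
have sh k := subspace_shomog K l 0 k.
have sker : subspace [set p | shomog 0 j p /\ I (f p)].
  by apply: subspaceI => //; apply: (subspace_preim f).
have [d hd] : exists d, has_qdim [set p | shomog 0 j p /\ I (f p)] I d.
  exact: (@homog_qdim_ex _ j sker (fun p => @proj1 _ _)).
have hs := has_qdim_ses (sh j) sI (sh j.+1) sI fdeg fI surj hd (hilbert_funP j.+1).
by rewrite (has_qdim_uniq sI (hilbert_funP j) hs) addnK.
Qed.

End HilbertFunction.

Lemma subspace_tor_boundary (K : fieldType) l (I : set {mpoly K[l]})
    (F : graded_free_resolution I) i : subspace (@tor_boundary _ _ _ F i).
Proof.
split=> [|c _ _ [u ->] [v ->]]; first by exists 0; rewrite mul0mx.
by exists (c *: u + v); rewrite mulmxDl scalemxAl.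
Qed.

(** The homology of a complex of finite-dimensional spaces is
    finite-dimensional. *)
Lemma tor_qdim_ex (K : fieldType) l (I : set {mpoly K[l]})
    (F : graded_free_resolution I) i k :
  exists d, has_qdim [set v | @tor_degree _ _ _ F i k v /\ tor_cycle v]
                     (@tor_boundary _ _ _ F i) d.
Proof.
have sB := subspace_tor_boundary F i.
apply: (has_qdim_ex (Y := fun m => delta_mx 0 m)) => // [|v _].
  apply: subspaceI; split.
  - by move=> m; rewrite mxE eqxx.
  - move=> c u v hu hv m; rewrite !mxE.
    have [->|/hu //] := eqVneq (u 0 m) 0.
    by rewrite mulr0 add0r => /hv.
  - by case: i {sB} => //= i; rewrite mul0mx.
  - case: i {sB} => //= i c u v hu hv.
    by rewrite mulmxDl -scalemxAl hu hv scaler0 addr0.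
exists (fun m => v 0 m); rewrite -row_sum_delta subrr; exact: subspace0.
Qed.

Theorem theorem6p3 (K : fieldType) (charK : [pchar K] =i pred0) (n : nat)
    (I : set {mpoly K[n.+1]})
    (stableI : strongly_stable I) (wlpI : weak_lefschetz I)
    (F : graded_free_resolution I)
    (G : graded_free_resolution (contraction I))
    (i j : nat) :
  graded_betti F i (i + j)
    = (graded_betti G i (i + j)
       + (if i is i'.+1 then 'C(n, i') else 0) * hilbert_drop I j.+1)%N.
Proof.
case: stableI => /monomial_ideal_mono mI stab.
have sI := subspace_mono mI.
have hV : has_qdim [set p | shomog 0 j p /\ ann_last I p] I (hilbert_drop I j.+1).
  apply: (kernel_qdim sI (f := @xmul K n.+1 n)).
  - exact: mono_xmul.
  - exact: shomog_xmul.
  - case: wlpI => ell hell /(_ j)[inj|surj]; [left|right].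
      move=> p /dhomog_shomog hp Ip; apply: inj => //.
      exact: (ann_last_linear mI stab).
    exact: (surj_last mI stab hell).
have [d hd] := tor_qdim_ex G i (i + j).
have hG := (betti_koszul (mono_homog_ideal (contraction_mono mI)) G i j d).2 hd.
have hS := koszul_last mI (stable_socle mI stab) hG hV.
rewrite /graded_betti (qdimE (subspace_tor_boundary G i) hd).
apply: (qdimE (subspace_tor_boundary F i)).
exact: (betti_koszul (mono_homog_ideal mI) F i j _).1 hS.
Qed.
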